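(* Let $q\geq 11$ be an odd prime power with $q\equiv2\pmod3$. Then $\mathrm{Aut}(\mathcal X_3)=G$.
   Context: Let $m=(q+1)/3$ and let $\mathcal X_3$ be the nonsingular projective model (defined over $\mathbb F_{q^2}$) of the plane curve $y^{q+1}+x^{2m}+x^m=0$; $\mathrm{Aut}(\mathcal X_3)$ is its full automorphism group over $\overline{\mathbb F}_{q^2}$. $G$ is the group of automorphisms of $\mathcal X_3$ generated by the maps $\theta_{\gamma,\delta}:(x,y)\mapsto(\gamma x,\delta y)$ with $\gamma^m=\delta^{q+1}=1$, together with $\theta_2:(x,y)\mapsto(1/x,\,y/x)$ and $\theta_3:(x,y)\mapsto(y^3/x^2,\,y/x)$; it has order $2(q+1)^2$. *)

(* Defs.v *)
From Stdlib Require List.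
From HB Require Import structures.
From mathcomp Require Import all_boot all_order all_algebra.
Set Implicit Arguments. Unset Strict Implicit. Unset Printing Implicit Defensive.
Import GRing.Theory.
Local Open Scope ring_scope.

Definition algebraic_over_prime (K : fieldType) (c : K) : Prop :=
  exists P : {poly K}, P != 0 /\ (forall i : nat, exists k : nat, P`_i = k%:R)
                       /\ root P c.

Definition ev2 (K L : fieldType) (iota : {rmorphism K -> L})
  (P : {poly {poly K}}) (x y : L) : L :=
  ((map_poly (map_poly iota) P).[y%:P]).[x].

Definition is_function_field_X3 (q : nat) (K L : fieldType)
  (iota : {rmorphism K -> L}) (x y : L) : Prop :=
  [/\ (forall p : {poly K}, (map_poly iota p).[x] = 0 -> p = 0),
      y ^+ q.+1 + x ^+ (2 * (q.+1 %/ 3)) + x ^+ (q.+1 %/ 3) = 0 &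
      (forall z : L, exists P Q : {poly {poly K}},
           ev2 iota Q x y != 0 /\ z = ev2 iota P x y / ev2 iota Q x y)].

(* K-automorphism of L (automorphism of the curve, acting on functions). *)
Definition is_Kaut (K L : fieldType) (iota : {rmorphism K -> L}) (s : L -> L)
  : Prop :=
  [/\ (forall a b, s (a + b) = s a + s b), (forall a b, s (a * b) = s a * s b),
      s 1 = 1, bijective s & (forall c : K, s (iota c) = iota c)].

(* The automorphism s is (the pullback of) one of the generators
   theta_{gamma,delta}, theta_2, theta_3 of G. *)
Definition is_generator_X3 (q : nat) (K L : fieldType)
  (iota : {rmorphism K -> L}) (x y : L) (s : L -> L) : Prop :=
  (exists gamma delta : K, gamma ^+ (q.+1 %/ 3) = 1 /\ delta ^+ q.+1 = 1 /\
       s x = iota gamma * x /\ s y = iota delta * y)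
  \/ (s x = x^-1 /\ s y = y / x)
  \/ (s x = y ^+ 3 / x ^+ 2 /\ s y = y / x).

Definition in_G_X3 (q : nat) (K L : fieldType)
  (iota : {rmorphism K -> L}) (x y : L) (s : L -> L) : Prop :=
  exists ts : seq (L -> L),
    List.Forall (fun t => is_Kaut iota t /\
        (is_generator_X3 q iota x y t \/
         exists r, is_Kaut iota r /\ is_generator_X3 q iota x y r /\
                   (forall z, r (t z) = z))) ts
    /\ (forall z, s z = foldr (fun t f => t \o f) id ts z).

(* Main.v *)
Require Import Defs.
From HB Require Import structures.
From mathcomp Require Import all_boot all_order all_algebra.
From mathcomp Require Import cyclic separable cyclotomic ring zify.
From Stdlib Require Import IndefiniteDescription.
Set Implicit Arguments. Unset Strict Implicit. Unset Printing Implicit Defensive.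
Import Order.TTheory GRing.Theory Num.Theory.
Local Open Scope ring_scope.

(** With z = y^3/x the curve lies in P^3 with coordinates (1 : x : y : z),
on the cubic surface y^3 = xz and on the surface 1 + x^m + z^m = 0. Let V be the span of
1, x, y, z and H the divisor of a plane section. For every point T = (1 : a : b : d) the
plane 1 + a^q x + d^q z - 3 b^q y = 0 meets the curve at T with multiplicity at least q,
because 1 + x^(q+1) + z^(q+1) - 3 y^(q+1) = 0 on the curve. If g has at most a pole of order
q+1 at T, the product of g with this linear form lies in L(H + T), and L(H + T) = V: after
multiplication by the linear forms vanishing at T one lands in L(2H), which is spanned by the
ten quadratic monomials. For the point P = (1 : zeta : 0 : 0) with zeta^m = -1, the plane
x = zeta cuts out exactly (q+1) P, so that V = (x - zeta) L((q+1) P). An automorphism s sends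
L((q+1) P) to L((q+1) s(P)), hence s(V) is a scalar multiple of V by a function and s is induced
by a linear map of P^3. As m > 3, the only cubic through the curve is y^3 = xz; its three
singular points are the coordinate points with y = 0, so s permutes 1, x, z up to
constants and fixes y up to a constant, and the equation of the curve determines the possible constants.

Divisors are encoded by the values of functions at all places, i.e. normalised discrete
valuations of L over K. *)

(** * The plane equation *)

Section Evaluation.
Variables (K M : fieldType) (j : {rmorphism K -> M}) (x y : M).
Implicit Types P Q : {poly {poly K}}.

Lemma ev2D P Q : ev2 j (P + Q) x y = ev2 j P x y + ev2 j Q x y.
Proof. by rewrite /ev2 rmorphD !hornerD. Qed.

Lemma ev2B P Q : ev2 j (P - Q) x y = ev2 j P x y - ev2 j Q x y.
Proof. by rewrite /ev2 rmorphB /= !hornerE. Qed.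

Lemma ev2M P Q : ev2 j (P * Q) x y = ev2 j P x y * ev2 j Q x y.
Proof. by rewrite /ev2 rmorphM /= !hornerE. Qed.

Lemma ev2C (p : {poly K}) : ev2 j p%:P x y = (map_poly j p).[x].
Proof. by rewrite /ev2 map_polyC hornerC. Qed.

Lemma ev2CC c : ev2 j c%:P%:P x y = j c.
Proof. by rewrite ev2C map_polyC hornerC. Qed.

Lemma ev2_0 : ev2 j 0 x y = 0.
Proof. by rewrite /ev2 rmorph0 !horner0. Qed.

Lemma ev2_1 : ev2 j 1 x y = 1.
Proof. by rewrite -(rmorph1 (@polyC _)) -(rmorph1 (@polyC _)) ev2CC rmorph1. Qed.

Lemma ev2X : ev2 j 'X%:P x y = x.
Proof. by rewrite ev2C map_polyX hornerX. Qed.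

Lemma ev2Y : ev2 j 'X x y = y.
Proof. by rewrite /ev2 map_polyX hornerX hornerC. Qed.

Lemma ev2_exp P n : ev2 j (P ^+ n) x y = ev2 j P x y ^+ n.
Proof. by elim: n => [|n IH]; rewrite ?expr0 ?ev2_1 // !exprS ev2M IH. Qed.

Lemma ev2_sum (I : Type) (r : seq I) (F : I -> {poly {poly K}}) :
  ev2 j (\sum_(i <- r) F i) x y = \sum_(i <- r) ev2 j (F i) x y.
Proof.
by elim: r => [|i r IH]; rewrite ?big_nil ?ev2_0 // !big_cons ev2D IH.
Qed.

Lemma ev2_coef P :
  ev2 j P x y = \sum_(i < size P) (map_poly j P`_i).[x] * y ^+ i.
Proof.
rewrite -{1}[P]coefK poly_def ev2_sum; apply: eq_bigr => i _.
by rewrite -mul_polyC ev2M ev2C ev2_exp ev2Y.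
Qed.

End Evaluation.

(** The equation is read as a polynomial in [y] over [K[x]]: it is monic there, so division by it
    needs no denominators. *)
Definition curve_poly (K : fieldType) (m : nat) : {poly {poly K}} :=
  'X^(3 * m) + ('X^(2 * m) + 'X^m)%:P.

Definition on_curve (M : fieldType) (m : nat) (x y : M) : Prop :=
  y ^+ (3 * m) + (x ^+ (2 * m) + x ^+ m) = 0.

Lemma ev2_curve (K M : fieldType) (j : {rmorphism K -> M}) m x y :
  ev2 j (curve_poly K m) x y = y ^+ (3 * m) + (x ^+ (2 * m) + x ^+ m).
Proof.
rewrite /curve_poly ev2D ev2_exp ev2Y ev2C; congr (_ + _).
by rewrite rmorphD /= !map_polyXn !hornerE.
Qed.

Section CurvePoly.
Variables (K : fieldType) (m : nat).
Hypothesis m_gt0 : (0 < m)%N.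

Lemma size_curve_poly : size (curve_poly K m) = (3 * m).+1.
Proof.
rewrite /curve_poly size_polyDl ?size_polyXn //.
by rewrite (leq_ltn_trans (size_polyC_leq1 _)) //; lia.
Qed.

Lemma curve_poly_monic : curve_poly K m \is monic.
Proof.
rewrite monicE /curve_poly lead_coefDl ?lead_coefXn // size_polyXn.
by rewrite (leq_ltn_trans (size_polyC_leq1 _)) //; lia.
Qed.

Hypothesis m_neq0 : m%:R != 0 :> K.
Variable zeta : K.
Hypothesis zetaP : zeta ^+ m = -1.

(** Reduction of the coefficients modulo [X - zeta], the prime of [K[X]] used in Eisenstein's
    argument. *)
Let red : {poly {poly K}} -> {poly K} := map_poly (horner_eval zeta).

Let redM P Q : red (P * Q) = red P * red Q.
Proof. exact: rmorphM. Qed.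

Let red_eq0 (R : {poly {poly K}}) : red R = 0 ->
  exists R', R = ('X - zeta%:P)%:P * R'.
Proof.
move=> h; exists (map_poly (fun p => p %/ ('X - zeta%:P)) R).
apply/polyP => i; rewrite coefCM coef_map_id0 ?div0p //.
have /polyP/(_ i) := h; rewrite coef_map coef0 /= /horner_eval => /eqP hr.
by rewrite mulrC divpK // dvdp_XsubCl.
Qed.

Let size_mulS (Q R : {poly {poly K}}) :
  Q != 0 -> R != 0 -> (size (Q * R)).+1 = (size Q + size R)%N.
Proof.
by move=> Q0 R0; rewrite size_mul // prednK // addn_gt0 size_poly_gt0 Q0.
Qed.

Let size_mulS1 (Q R : {poly K}) :
  Q != 0 -> R != 0 -> (size (Q * R)).+1 = (size Q + size R)%N.
Proof.
by move=> Q0 R0; rewrite size_mul // prednK // addn_gt0 size_poly_gt0 Q0.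
Qed.

Let e_root : ('X^(2 * m) + 'X^m).[zeta] = 0.
Proof.
by rewrite hornerD !hornerXn mul2n -addnn exprD zetaP mulrNN mulr1 subrr.
Qed.

Let e_deriv : ('X^(2 * m) + 'X^m)^`().[zeta] = - (zeta ^+ m.-1 * m%:R).
Proof.
have em : ((2 * m).-1 = m + m.-1)%N by lia.
rewrite derivD !derivXn !hornerE !hornerMn !hornerXn em exprD zetaP.
by rewrite mul2n -addnn mulrnDr mulN1r mulNrn addrNK mulr_natr.
Qed.

Let e_deriv_neq0 : - (zeta ^+ m.-1 * m%:R) != 0.
Proof.
rewrite oppr_eq0 mulf_eq0 (negPf m_neq0) orbF expf_eq0 negb_and orbC.
apply/orP; left; apply: contra_eqN zetaP => /eqP->.
by rewrite expr0n (gtn_eqF m_gt0) eq_sym oppr_eq0 oner_eq0.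
Qed.

Let arith (a b d N : nat) : (a + b = N.+2 -> b <= d -> d <= N -> 1 < a)%N.
Proof. by lia. Qed.

(* Eisenstein at the simple root [zeta] of [X^m + 1], after clearing the content. *)
Lemma curve_poly_irreducible (c : {poly K}) (Q R : {poly {poly K}}) :
  c != 0 -> c *: curve_poly K m = Q * R -> (1 < size R <= 3 * m)%N -> False.
Proof.
have [n] := ubnP (size c); elim: n => // n IH in c Q R *.
move=> szc c0 eqQR szR.
have X0 : 'X - zeta%:P != 0 by rewrite polyXsubC_eq0.
have E0 : curve_poly K m != 0 by rewrite -size_poly_eq0 size_curve_poly.
have Xp0 : ('X - zeta%:P)%:P != 0 :> {poly {poly K}} by rewrite polyC_eq0.
have redE : red (c *: curve_poly K m) = c.[zeta] *: 'X^(3 * m).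
  apply/polyP => i; rewrite coef_map /= /horner_eval coefZ hornerM.
  rewrite coefZ coefD coefC !coefXn hornerD; congr (_ * _).
  have -> : (if i == 0%N then 'X^(2 * m) + 'X^m else 0).[zeta] = 0.
    by case: ifP => _; rewrite ?e_root ?horner0.
  by rewrite addr0 -polyC_natr hornerC.
(* If [X - zeta] divides [c], it divides one of the factors by primality. Cancelling it lowers the
   degree of [c] and leaves the size of the second factor unchanged. *)
have [cz|cz] := eqVneq c.[zeta] 0.
  have /factor_theorem [c' cE] : root c zeta by apply/eqP.
  have c'0 : c' != 0 by apply: contraNneq c0 => h; rewrite cE h mul0r.
  have szc' : (size c' < n)%N.
    by move: szc; rewrite cE size_Mmonic ?monicXsubC // size_XsubC addn2.
  have : red Q * red R = 0 by rewrite -redM -eqQR redE cz scale0r.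
  move/eqP; rewrite mulf_eq0 => /orP[] /eqP /red_eq0 [S eqS].
    apply: (IH c' S R) => //; apply: (mulfI Xp0).
    by rewrite mulrA -eqS -eqQR cE -!mul_polyC polyCM; ring.
  have S0 : S != 0.
    by move: szR; apply: contraTneq => h; rewrite eqS h mulr0 size_poly0.
  have szS : size S = size R by rewrite eqS mul_polyC size_scale.
  apply: (IH c' Q S) => //; last by rewrite szS.
  apply: (mulfI Xp0).
  by rewrite mulrCA -eqS -eqQR cE -!mul_polyC polyCM; ring.
have Q0 : Q != 0.
  apply: contraNneq c0 => h; move/eqP: eqQR.
  by rewrite h mul0r -mul_polyC mulf_eq0 polyC_eq0 (negPf E0) orbF.
have R0 : R != 0 by move: szR; apply: contraTneq => ->; rewrite size_poly0.
have szQR : (size Q + size R = (3 * m).+2)%N.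
  by rewrite -size_mulS // -eqQR size_scale // size_curve_poly.
have eqr : c.[zeta] *: 'X^(3 * m) = red Q * red R.
  by rewrite -redE eqQR redM.
have rQR0 : red Q * red R != 0.
  by rewrite -eqr scaler_eq0 (negPf cz) /= -size_poly_eq0 size_polyXn.
have rQ0 : red Q != 0 by move: rQR0; rewrite mulf_eq0; case/norP.
have rR0 : red R != 0 by move: rQR0; rewrite mulf_eq0; case/norP.
have szr : (size (red Q) + size (red R) = (3 * m).+2)%N.
  by rewrite -size_mulS1 // -eqr size_scale // size_polyXn.
have leQ : (size (red Q) <= size Q)%N by apply: size_poly.
have leR : (size (red R) <= size R)%N by apply: size_poly.
(* Both reductions divide a power of the variable, so a reduction of positive degree has no constant
   term. *)
have root0 S : S %| 'X^(3 * m) -> (1 < size S)%N -> S.[0] = 0 :> K.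
  rewrite -{1}['X]subr0 => /dvdp_exp_XsubCP [k _].
  rewrite subr0 => eqS szS; apply/eqP.
  have k0 : (0 < k)%N.
    by move: szS; rewrite (eqp_size eqS) size_polyXn ltnS.
  rewrite -/(root S 0) (eqp_root eqS) rootE !hornerE expr0n.
  by rewrite (negPf (lt0n_neq0 k0)).
have dQ : red Q %| 'X^(3 * m).
  by rewrite -(dvdpZr _ _ cz) eqr dvdp_mulr.
have dR : red R %| 'X^(3 * m).
  by rewrite -(dvdpZr _ _ cz) eqr dvdp_mull.
have [szR1 szR2] := andP szR.
have szQ2 : (size Q <= 3 * m)%N.
  by rewrite -(leq_add2r (size R)) szQR -addn2 leq_add2l.
have Qz : (Q`_0).[zeta] = 0.
  have := root0 _ dQ; rewrite horner_coef0 coef_map /= /horner_eval; apply.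
  exact: arith szr leR szR2.
have Rz : (R`_0).[zeta] = 0.
  have := root0 _ dR; rewrite horner_coef0 coef_map /= /horner_eval; apply.
  by apply: (arith _ leQ szQ2); rewrite addnC; exact: szr.
(* The constant coefficients of [Q] and [R] both vanish at [zeta], so their product has derivative
   zero there. The left side has a simple root at [zeta]: a contradiction. *)
have /polyP/(_ 0%N) := eqQR; rewrite coefZ coef0M coefD coefC eqxx coefXn.
rewrite eq_sym muln_eq0 /= (gtn_eqF m_gt0).
rewrite add0r => /(congr1 (fun p => p^`().[zeta])); rewrite !derivM !hornerD !hornerM.
rewrite e_root e_deriv Qz Rz !mulr0 !mul0r !add0r => /eqP.
by rewrite mulf_eq0 (negPf cz) (negPf e_deriv_neq0).
Qed.

End CurvePoly.

(** * Relations between [x] and [y], and substitutions *)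

Definition transcendental (K L : fieldType) (iota : {rmorphism K -> L}) (t : L) :=
  forall p : {poly K}, (map_poly iota p).[t] = 0 -> p = 0.

(** Over an algebraically closed field a polynomial splits into linear factors, and none of them
    vanishes at a nonconstant element. *)
Lemma transcendentalP (K : closedFieldType) (L : fieldType)
  (iota : {rmorphism K -> L}) (t : L) :
  (forall c, t <> iota c) -> transcendental iota t.
Proof.
move=> tK p pt0; apply/eqP; apply: contraT => p0.
have [r pE] := closed_field_poly_normal p.
move: pt0; rewrite pE linearZ /= hornerZ => /eqP.
rewrite mulf_eq0 fmorph_eq0 lead_coef_eq0 (negPf p0) /= rmorph_prod horner_prod.
rewrite prodf_seq_eq0 => /hasP[c _] /=.
rewrite rmorphB /= map_polyX map_polyC hornerXsubC subr_eq0 => /eqP /tK.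
by [].
Qed.

Lemma transcendental_neq (K L : fieldType) (iota : {rmorphism K -> L}) (t : L) c :
  transcendental iota t -> t <> iota c.
Proof.
move=> tt tc; have : 'X - c%:P = 0.
  by apply: tt; rewrite rmorphB /= map_polyX map_polyC hornerXsubC tc subrr.
by apply/eqP; rewrite polyXsubC_eq0.
Qed.

Lemma rmorph_ev2 (K L M : fieldType) (j : {rmorphism K -> L}) (k : {rmorphism K -> M})
    (s : {rmorphism L -> M}) P x y :
  (forall c, s (j c) = k c) -> s (ev2 j P x y) = ev2 k P (s x) (s y).
Proof.
move=> sj; rewrite !ev2_coef rmorph_sum; apply: eq_bigr => i _.
rewrite rmorphM rmorphXn -horner_map -map_poly_comp; congr (_.[_] * _).
exact: eq_map_poly.
Qed.

Section Curve.
Variables (K : closedFieldType) (L : fieldType) (iota : {rmorphism K -> L}) (m : nat).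
Hypotheses (m_ge4 : (4 <= m)%N) (m3 : (3 * m)%:R = 1 :> K).

Lemma m_neq0 : m%:R != 0 :> K.
Proof.
by apply/eqP => h; move/eqP: m3; rewrite natrM h mulr0 eq_sym oner_eq0.
Qed.

Lemma zeta_exists : exists zeta : K, zeta ^+ m = -1.
Proof.
have m0 : (0 < m)%N by lia.
have /closed_rootP [z /rootP] : size ('X^m + 1%:P : {poly K}) != 1%N.
  rewrite size_polyDl size_polyXn ?size_polyC ?oner_neq0 //.
  by rewrite eqSS (gtn_eqF m0).
by rewrite !hornerE => /eqP; rewrite addr_eq0 => /eqP; exists z.
Qed.

Section Generic.
Variables x y : L.
Hypotheses (xT : transcendental iota x) (xy : on_curve m x y).

(** The remainder of [curve_poly] modulo a relation [P] is a shorter relation, hence zero by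
    induction. So [P] divides a nonzero [K[x]]-multiple of [curve_poly], against irreducibility. *)
Lemma curve_independent (P : {poly {poly K}}) : (size P <= 3 * m)%N -> ev2 iota P x y = 0 -> P = 0.
Proof.
have m0 : (0 < m)%N by lia.
have [n] := ubnP (size P); elim: n => // n IH in P *; rewrite ltnS => szn szP evP.
apply/eqP; apply: contraT => P0.
have [sz1|sz1] := leqP (size P) 1.
  have /eqP := size1_polyC sz1; move: evP; set c := P`_0 => evP /eqP Pc.
  move: evP P0; rewrite Pc ev2C => /xT ->.
  by rewrite polyC0 eqxx.
have [c [Q [c0 dE]]] : exists (c : {poly K}) (Q : {poly {poly K}}),
    c != 0 /\ c *: curve_poly K m = Q * P + modp (curve_poly K m) P.
  (* Pseudo-division: [K[x]] is not a field, so [curve_poly] is first multiplied by a power of the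
     leading coefficient of [P]. *)
  exists (lead_coef P ^+ scalp (curve_poly K m) P), (divp (curve_poly K m) P).
  split; last exact: Pdiv.WeakIdomain.divp_eq.
  by rewrite expf_neq0 // lead_coef_eq0.
have r0 : modp (curve_poly K m) P = 0.
  have ltr : (size (modp (curve_poly K m) P) < size P)%N by rewrite ltn_modpN0.
  apply: IH; first exact: leq_trans ltr szn.
    exact: leq_trans (ltnW ltr) szP.
  have := congr1 (fun S => ev2 iota S x y) dE.
  by rewrite -mul_polyC ev2M ev2_curve xy ev2D ev2M evP !mulr0 add0r.
have [zeta zetaP] := zeta_exists.
move: dE; rewrite r0 addr0 => /(curve_poly_irreducible m0 m_neq0 zetaP) F.
by case: F => //; rewrite sz1 szP.
Qed.

(** Division by the monic [curve_poly] leaves a remainder that vanishes by independence. This makes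
    evaluation at a point of the curve, over any field, well defined on functions. *)
Lemma ev2_kernel (M : fieldType) (j : {rmorphism K -> M}) (x' y' : M) P :
  on_curve m x' y' -> ev2 iota P x y = 0 -> ev2 j P x' y' = 0.
Proof.
move=> xy' evP.
have m0 : (0 < m)%N by lia.
have cm := curve_poly_monic K m0.
have dE := Pdiv.RingMonic.rdivp_eq cm P.
have r0 : Pdiv.CommonRing.rmodp P (curve_poly K m) = 0.
  apply: curve_independent.
    by rewrite -ltnS -(size_curve_poly K m0) Pdiv.CommonRing.ltn_rmodpN0 // monic_neq0.
  have := evP; rewrite {1}dE ev2D ev2M.
  by rewrite ev2_curve xy mulr0 add0r.
by rewrite dE r0 addr0 ev2M ev2_curve xy' mulr0.
Qed.

(** [B] is integral over [K[x]], since [y] is. In an integral equation with nonzero constant term,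
    that term is a multiple of [B]; it plays the part of a norm. *)
Lemma ev2_multiple_in_x B : ev2 iota B x y != 0 ->
  exists C r, r != 0 /\ ev2 iota B x y * ev2 iota C x y = (map_poly iota r).[x].
Proof.
move=> B0.
have cfu : commr_rmorph iota x by move=> c; apply: mulrC.
have [f fE] : exists f : {rmorphism {poly K} -> L},
    forall p, f p = (map_poly iota p).[x] by exists (horner_morph cfu).
have intB : integralOver f (ev2 iota B x y).
  rewrite ev2_coef.
  have inty : integralOver f y.
    exists (curve_poly K m); first by apply: curve_poly_monic; lia.
    rewrite rootE /curve_poly rmorphD /= map_polyXn map_polyC hornerD hornerXn.
    by rewrite hornerC /= fE rmorphD /= !map_polyXn hornerD !hornerXn; apply/eqP; exact: xy.
  apply: (big_ind (integralOver f)) => [||i _].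
  - exact: integral0.
  - by move=> u v; apply: integral_add.
  apply: integral_mul; first by rewrite -fE; apply: integral_id.
  elim: (nat_of_ord i) => [|k IH]; first by rewrite expr0; apply: integral1.
  by rewrite exprS; apply: integral_mul.
have evp (p : {poly {poly K}}) :
    exists C, (map_poly f p).[ev2 iota B x y] = ev2 iota C x y.
  elim/poly_ind: p => [|p c [C IH]]; first by exists 0; rewrite rmorph0 horner0 ev2_0.
  exists (C * B + c%:P); rewrite rmorphD rmorphM /= map_polyX map_polyC hornerMXaddC.
  by rewrite IH ev2D ev2M ev2C /= fE.
case: intB => p /monic_neq0 p0 /rootP.
(* A zero constant coefficient is removed by cancelling the nonzero value of [B]; a nonzero one
   gives [r = - c]. *)
elim/poly_ind: p p0 => [|p c IH]; first by rewrite eqxx.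
rewrite rmorphD rmorphM /= map_polyX map_polyC hornerMXaddC.
have [->|c0] := eqVneq c 0.
  rewrite polyC0 addr0 /= rmorph0 addr0 => pX0 /eqP; rewrite mulf_eq0 (negPf B0) orbF => /eqP.
  by apply: IH; apply: contraNneq pX0 => ->; rewrite mul0r.
move=> _; have [C ->] := evp p => /eqP; rewrite addr_eq0 => /eqP h.
exists C, (- c); rewrite oppr_eq0 c0; split=> //.
by rewrite mulrC h rmorphN hornerN -fE.
Qed.

End Generic.

Section Generated.
Variables x y : L.
Hypotheses (xT : transcendental iota x) (xy : on_curve m x y).
Hypothesis gen : forall z : L, exists P Q : {poly {poly K}},
  ev2 iota Q x y != 0 /\ z = ev2 iota P x y / ev2 iota Q x y.

(** The denominator is multiplied up to a polynomial in [x], then the numerator is reduced modulo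
    the equation. *)
Lemma basis_representation z : exists (P : {poly {poly K}}) (r : {poly K}),
  [/\ (size P <= 3 * m)%N, r != 0 & z = ev2 iota P x y / (map_poly iota r).[x]].
Proof.
have [A [B [B0 ->]]] := gen z.
have [C [r [r0 BC]]] := ev2_multiple_in_x xy B0.
have m0 : (0 < m)%N by lia.
have cm := curve_poly_monic K m0.
exists (Pdiv.CommonRing.rmodp (A * C) (curve_poly K m)), r; split => //.
  by rewrite -ltnS -(size_curve_poly K m0) Pdiv.CommonRing.ltn_rmodpN0 // monic_neq0.
have C0 : ev2 iota C x y != 0.
  apply: contraNneq r0 => C0; apply/eqP/xT.
  by rewrite -BC C0 mulr0.
have := congr1 (fun Q => ev2 iota Q x y) (Pdiv.RingMonic.rdivp_eq cm (A * C)).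
rewrite [RHS]ev2D [X in _ = X + _]ev2M ev2_curve xy mulr0 add0r => <-.
by rewrite -BC ev2M -mulf_div divff // mulr1.
Qed.

Lemma rmorph_ext (r s : {rmorphism L -> L}) :
  (forall c, r (iota c) = s (iota c)) -> r x = s x -> r y = s y -> r =1 s.
Proof.
move=> rs rsx rsy z; have [P [Q [_ ->]]] := gen z.
pose k : {rmorphism K -> L} := s \o iota.
by rewrite !fmorph_div /= !(rmorph_ev2 (k := k)) ?rsx ?rsy.
Qed.

(** A point of the curve with transcendental first coordinate satisfies exactly the relations of
    [(x, y)]: [ev2_kernel] applies in both directions, so nonzero denominators stay nonzero. *)
Lemma substitution (x' y' : L) : transcendental iota x' -> on_curve m x' y' ->
  exists s : {rmorphism L -> L}, [/\ forall c, s (iota c) = iota c, s x = x' & s y = y'].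
Proof.
move=> xT' xy'.
have ker P : ev2 iota P x' y' = 0 -> ev2 iota P x y = 0 by apply: ev2_kernel.
have ex z : exists PQ : {poly {poly K}} * {poly {poly K}},
    (ev2 iota PQ.2 x y != 0) && (z == ev2 iota PQ.1 x y / ev2 iota PQ.2 x y).
  by have [P [Q [Q0 ->]]] := gen z; exists (P, Q); rewrite /= Q0 eqxx.
(* [s] is defined through a chosen fraction; [sE] shows that every other fraction gives the same
   result. *)
pose s z := let PQ := xchoose (ex z) in
  ev2 iota PQ.1 x' y' / ev2 iota PQ.2 x' y'.
have sE P Q : ev2 iota Q x y != 0 ->
    s (ev2 iota P x y / ev2 iota Q x y) = ev2 iota P x' y' / ev2 iota Q x' y'.
  move=> Q0; rewrite /s.
  case: (xchoose _) (xchooseP (ex (ev2 iota P x y / ev2 iota Q x y))) => P1 Q1 /=.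
  case/andP => Q10; rewrite eqr_div // => /eqP e.
  have nz R : ev2 iota R x y != 0 -> ev2 iota R x' y' != 0.
    by move=> R0; apply: contraNneq R0 => /ker ->.
  have : ev2 iota (P1 * Q - P * Q1) x' y' = 0.
    by apply: (ev2_kernel xT xy iota xy'); rewrite ev2B !ev2M e subrr.
  rewrite ev2B !ev2M => /eqP; rewrite subr_eq0 => e'.
  by apply/eqP; rewrite eqr_div ?nz.
clearbody s.
have s1E P : s (ev2 iota P x y) = ev2 iota P x' y'.
  have := sE P 1; rewrite !ev2_1 !divr1; apply; exact: oner_neq0.
have nz R : ev2 iota R x y != 0 -> ev2 iota R x' y' != 0.
  by move=> R0; apply: contraNneq R0 => /ker ->.
have sB : zmod_morphism s.
  move=> u v; have [P [Q [Q0 ->]]] := gen u; have [R [S [S0 ->]]] := gen v.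
  rewrite -mulNr addf_div // mulNr -!ev2M -ev2B sE ?ev2M ?mulf_neq0 // !sE //.
  by rewrite ev2B !ev2M -[X in _ = _ + X]mulNr addf_div ?nz // mulNr.
have sM : monoid_morphism s.
  split; first by rewrite -(ev2_1 iota x y) s1E !ev2_1.
  move=> u v; have [P [Q [Q0 ->]]] := gen u; have [R [S [S0 ->]]] := gen v.
  by rewrite mulf_div -!ev2M !sE ?ev2M ?mulf_neq0 // -mulf_div.
exists (HB.pack_for {rmorphism L -> L} s (GRing.isZmodMorphism.Build L L s sB)
                  (GRing.isMonoidMorphism.Build L L s sM)).
split=> /= [c||].
- by rewrite -(ev2CC iota x y) s1E !ev2CC.
- by rewrite -[in LHS](ev2X iota x y) s1E ev2X.
- by rewrite -[in LHS](ev2Y iota x y) s1E ev2Y.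
Qed.

End Generated.
End Curve.

(** * Places *)

(* A place is a normalised discrete valuation trivial on the constants; its value
   at [0] is junk, which [vge] repairs. *)
Record is_place (K L : fieldType) (iota : {rmorphism K -> L}) (v : L -> int) : Prop :=
  IsPlace {
  placeM : forall f g, f != 0 -> g != 0 -> v (f * g) = v f + v g;
  placeD : forall n f g, f != 0 -> g != 0 -> f + g != 0 ->
    n <= v f -> n <= v g -> n <= v (f + g);
  placeC : forall c, c != 0 -> v (iota c) = 0;
  place1 : exists f, f != 0 /\ v f = 1 }.

Definition vge (L : fieldType) (v : L -> int) (n : int) (f : L) : Prop :=
  f = 0 \/ n <= v f.

Section Place.
Variables (K L : fieldType) (iota : {rmorphism K -> L}) (v : L -> int).
Hypothesis vP : is_place iota v.

Lemma place_one : v 1 = 0.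
Proof. by rewrite -(rmorph1 iota) (placeC vP) ?oner_neq0. Qed.

Lemma placeX f n : f != 0 -> v (f ^+ n) = v f * n%:Z.
Proof.
move=> f0; elim: n => [|n IH]; first by rewrite expr0 place_one mulr0.
rewrite exprS (placeM vP) ?expf_neq0 // IH; lia.
Qed.

Lemma placeV f : f != 0 -> v f^-1 = - v f.
Proof.
move=> f0; have := placeM vP f0 (invr_neq0 f0).
by rewrite divff // place_one => h; lia.
Qed.

Lemma place_div f g : f != 0 -> g != 0 -> v (f / g) = v f - v g.
Proof. by move=> f0 g0; rewrite (placeM vP) ?invr_neq0 // placeV. Qed.

Lemma placeN f : v (- f) = v f.
Proof.
have [->|f0] := eqVneq f 0; first by rewrite oppr0.
rewrite -mulN1r -(rmorph1 iota) -rmorphN (placeM vP) //; last first.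
  by rewrite fmorph_eq0 oppr_eq0 oner_eq0.
by rewrite (placeC vP) ?add0r // oppr_eq0 oner_eq0.
Qed.

Lemma vge0 n : vge v n 0. Proof. by left. Qed.

Lemma vgeE n f : f != 0 -> vge v n f -> n <= v f.
Proof. by move=> f0 [f0'|//]; rewrite f0' eqxx in f0. Qed.

Lemma vge_le n k f : k <= n -> vge v n f -> vge v k f.
Proof. by move=> kn [->|h]; [left | right; apply: le_trans h]. Qed.

Lemma vgeN n f : vge v n f -> vge v n (- f).
Proof. by move=> [->|h]; [rewrite oppr0; left | right; rewrite placeN]. Qed.

Lemma vgeD n f g : vge v n f -> vge v n g -> vge v n (f + g).
Proof.
case=> [->|hf]; first by rewrite add0r.
have [->|f0] := eqVneq f 0; first by rewrite add0r.
case=> [->|hg]; first by rewrite addr0; right.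
have [->|g0] := eqVneq g 0; first by rewrite addr0; right.
have [->|fg0] := eqVneq (f + g) 0; first by left.
by right; apply: (placeD vP).
Qed.

Lemma vgeB n f g : vge v n f -> vge v n g -> vge v n (f - g).
Proof. by move=> hf /vgeN; apply: vgeD. Qed.

Lemma vgeM n k f g : vge v n f -> vge v k g -> vge v (n + k) (f * g).
Proof.
case=> [->|hf]; first by rewrite mul0r; left.
have [->|f0] := eqVneq f 0; first by rewrite mul0r; left.
case=> [->|hg]; first by rewrite mulr0; left.
have [->|g0] := eqVneq g 0; first by rewrite mulr0; left.
by right; rewrite (placeM vP) // lerD.
Qed.

Lemma vgeX n f k : vge v n f -> vge v (n * k%:Z) (f ^+ k).
Proof.
move=> h; elim: k => [|k IH]; first by rewrite expr0 mulr0; right; rewrite place_one.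
rewrite exprS (_ : n * k.+1%:Z = n + n * k%:Z); last by lia.
exact: vgeM.
Qed.

Lemma vge_const c : vge v 0 (iota c).
Proof.
have [->|c0] := eqVneq c 0; first by rewrite rmorph0; left.
by right; rewrite (placeC vP).
Qed.

Lemma vge_sum (I : Type) (r : seq I) (P : pred I) n (F : I -> L) :
  (forall i, P i -> vge v n (F i)) -> vge v n (\sum_(i <- r | P i) F i).
Proof.
move=> h; elim/big_ind: _ => //; first exact: vge0.
by move=> *; apply: vgeD.
Qed.

Lemma vge_prod_pos (I : Type) (r : seq I) (F : I -> L) :
  (forall i, vge v 0 (F i)) -> vge v 1 (\prod_(i <- r) F i) ->
  (forall i, F i != 0) -> exists i, vge v 1 (F i).
Proof.
move=> h0 + F0; elim: r => [|i r IH]; first by rewrite big_nil => /vgeE; rewrite place_one oner_neq0 => /(_ isT).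
rewrite big_cons => h; have [h1|h1] := lerP 1 (v (F i)); first by exists i; right.
have F1 : \prod_(i <- r) F i != 0.
  by rewrite prodf_seq_neq0; elim: (r) => //= j s ->; rewrite F0.
apply: IH; right; have := vgeE _ h; rewrite mulf_neq0 // (placeM vP) // => /(_ isT).
by have := vgeE (F0 i) (h0 i); lia.
Qed.

(** The strict form of the ultrametric inequality: were the value of the sum larger,
    [f = (f + g) - g] would have value above [v f]. *)
Lemma place_dominant f g : f != 0 -> vge v (v f + 1) g -> v (f + g) = v f /\ f + g != 0.
Proof.
move=> f0 hg; have fg0 : f + g != 0.
  apply: contraTneq isT => fg; have : vge v (v f + 1) (- g) by apply: vgeN.
  have -> : - g = f by apply/esym/eqP; rewrite -addr_eq0 fg.
  by move/(vgeE f0); lia.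
split=> //; apply: le_anti; apply/andP; split; last first.
  apply: (vgeE fg0); apply: vgeD; first by right.
  by apply: vge_le hg; lia.
rewrite leNgt; apply/negP => lt.
have : vge v (v f + 1) (f + g - g).
  by apply: vgeB => //; right; lia.
by rewrite addrK => /(vgeE f0); lia.
Qed.

Lemma vge_horner t (p : {poly K}) : vge v 0 t -> vge v 0 (map_poly iota p).[t].
Proof.
move=> ht; elim/poly_ind: p => [|p c IH]; first by rewrite rmorph0 horner0; left.
rewrite rmorphD rmorphM /= map_polyX map_polyC hornerMXaddC.
by apply: vgeD; [rewrite -[0]addr0; apply: vgeM | apply: vge_const].
Qed.

Lemma place_horner_center t a (p : {poly K}) : vge v 1 (t - iota a) ->
  vge v 1 ((map_poly iota p).[t] - iota p.[a]).
Proof.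
move=> ta; have : root (p - p.[a]%:P) a by rewrite rootE !hornerE subrr.
case/factor_theorem => q qE.
have -> : p = q * ('X - a%:P) + p.[a]%:P by rewrite -qE subrK.
rewrite !rmorphD rmorphM rmorphB /= map_polyX !map_polyC /= !hornerE /=.
rewrite subrr mulr0 add0r addrK -[1]add0r; apply: vgeM => //.
apply: vge_horner; rewrite -[t](subrK (iota a)); apply: vgeD.
  by apply: vge_le ta; lia.
exact: vge_const.
Qed.

Lemma place_horner_unit t a (p : {poly K}) : vge v 1 (t - iota a) -> p.[a] != 0 ->
  v (map_poly iota p).[t] = 0 /\ (map_poly iota p).[t] != 0.
Proof.
move=> ta pa; have := place_horner_center p ta; set P := (map_poly iota p).[t].
move=> h; have i0 : iota p.[a] != 0 by rewrite fmorph_eq0.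
have := @place_dominant (iota p.[a]) (P - iota p.[a]) i0.
by rewrite (placeC vP) // add0r subrKC; apply.
Qed.

Lemma place_horner_pole t (p : {poly K}) : t != 0 -> v t < 0 -> p != 0 ->
  v (map_poly iota p).[t] = v t * (size p).-1%:Z /\ (map_poly iota p).[t] != 0.
Proof.
move=> t0 vt; elim/poly_ind: p => [|p c IH p0]; first by rewrite eqxx.
rewrite rmorphD rmorphM /= map_polyX map_polyC hornerMXaddC size_MXaddC.
have [p0'|p0'] := eqVneq p 0.
  have c0 : c != 0 by apply: contraNneq p0 => c0; rewrite p0' c0 mul0r polyC0 addr0.
  rewrite p0' rmorph0 horner0 mul0r add0r (negPf c0) andbF size_poly0 mulr0.
  by rewrite (placeC vP) // fmorph_eq0.
have [IH1 IH2] := IH p0'.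
have e : (map_poly iota p).[t] * t != 0 by rewrite mulf_neq0.
have ve : v ((map_poly iota p).[t] * t) = v t * (size p)%:Z.
  rewrite (placeM vP) // IH1; have := size_poly_gt0 p; rewrite p0'.
  by case: (size p) => // k _; lia.
rewrite /= -ve; apply: (place_dominant e); apply: vge_le (vge_const c).
rewrite ve; have := size_poly_gt0 p; rewrite p0'.
by case: (size p) => // k _; nia.
Qed.

End Place.

(** The polynomial splits into linear factors; all their values at [t] are nonnegative, so one of
    them is positive. *)
Lemma place_poly_root (K : closedFieldType) (L : fieldType) (iota : {rmorphism K -> L})
    (v : L -> int) (t : L) (p : {poly K}) :
  is_place iota v -> vge v 0 t -> (forall c, t != iota c) -> p != 0 ->
  vge v 1 (map_poly iota p).[t] -> exists c, vge v 1 (t - iota c).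
Proof.
move=> vP t0 tT p0; have [r pE] := closed_field_poly_normal p.
have l0 : lead_coef p != 0 by rewrite lead_coef_eq0.
have cX c : (map_poly iota ('X - c%:P)).[t] = t - iota c.
  by rewrite rmorphB /= map_polyX map_polyC hornerXsubC.
rewrite pE linearZ /= hornerZ rmorph_prod horner_prod.
have tc0 c : t - iota c != 0 by rewrite subr_eq0.
have P0 : \prod_(c <- r) (map_poly iota ('X - c%:P)).[t] != 0.
  by rewrite prodf_seq_neq0; apply/allP => c _; rewrite /= cX.
move=> h; have : vge v 1 (\prod_(c <- r) (map_poly iota ('X - c%:P)).[t]).
  right; have := vgeE _ h; rewrite mulf_neq0 ?fmorph_eq0 // => /(_ isT).
  by rewrite (placeM vP) ?fmorph_eq0 // (placeC vP) // add0r.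
case/(vge_prod_pos vP) => [c|c|c]; rewrite ?cX //; last by exists c.
by apply: (vgeB vP) => //; apply: vge_const vP _.
Qed.

(** * The valuation of a local ring with principal maximal ideal *)

Section LocalRing.
Variables (K L : fieldType) (iota : {rmorphism K -> L}) (val : L -> K -> Prop) (s : L).
(* [val u c]: the function [u] is regular at the given point, with value [c]. *)
Hypotheses (val_fun : forall u c d, val u c -> val u d -> c = d)
  (val_const : forall c, val (iota c) c)
  (valD : forall u c u' c', val u c -> val u' c' -> val (u + u') (c + c'))
  (valM : forall u c u' c', val u c -> val u' c' -> val (u * u') (c * c'))
  (valV : forall u c, val u c -> c != 0 -> val u^-1 c^-1)
  (val_frac : forall f, exists u c u' c', [/\ val u c, val u' c', u' != 0 & f = u / u'])
  (s_neq0 : s != 0) (val_s : val s 0)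
  (val_divs : forall u, val u 0 -> exists c, val (u / s) c)
  (val_bound : forall u c, val u c -> u != 0 -> exists N, forall d, ~ val (u / s ^+ N) d).

Let val1 : val 1 1. Proof. by rewrite -(rmorph1 iota). Qed.

Let valX u c n : val u c -> val (u ^+ n) (c ^+ n).
Proof.
by move=> h; elim: n => [|n IH]; rewrite ?expr0 // !exprS; apply: valM.
Qed.

Let val_neq0 u c : val u c -> c != 0 -> u != 0.
Proof.
move=> uc; apply: contraNneq => u0; apply/eqP; apply: val_fun uc _.
by rewrite u0 -(rmorph0 iota).
Qed.

(** A regular function vanishing at the point can be divided by [s] ([val_divs]), and only finitely
    often ([val_bound]), so a unit remains. General functions are quotients of regular ones. *)
Lemma local_factor f : f != 0 ->
  exists (k : int) u c, [/\ f = s ^ k * u, val u c & c != 0].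
Proof.
move=> f0.
have reg u c : val u c -> u != 0 -> exists (k : nat) u' c', [/\ u = s ^+ k * u', val u' c' & c' != 0].
  move=> uc u0; have [N] := val_bound uc u0.
  elim: N u c uc u0 => [|N IH] u c uc u0 nv; first by case: (nv c); rewrite expr0 divr1.
  have [c0|c0] := eqVneq c 0; last by exists 0%N, u, c; rewrite expr0 mul1r.
  have [d ud] : exists d, val (u / s) d by apply: val_divs; rewrite -c0.
  have [||k [u' [c' [uE vu' c'0]]]] := IH _ _ ud.
  - by rewrite mulf_neq0 ?invr_neq0.
  - by move=> d'; rewrite -mulrA -invfM -exprS; apply: nv.
  by exists k.+1, u', c'; split=> //; rewrite exprS -mulrA -uE mulrC divfK.
have [u [c [u' [c' [uc uc' u'0 fE]]]]] := val_frac f.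
have u0 : u != 0 by apply: contraNneq f0 => u0; rewrite fE u0 mul0r.
have [k [w [d [uE wd d0]]]] := reg u c uc u0.
have [k' [w' [d' [uE' wd' d0']]]] := reg u' c' uc' u'0.
exists (k%:Z - k'%:Z), (w / w'), (d / d'); split; last by rewrite mulf_neq0 ?invr_neq0.
  by rewrite fE uE uE' expfzDr // -exprnN -exprnP -mulf_div.
by apply: valM => //; apply: valV.
Qed.

Let val_pos n u c : val u c -> (0 < n)%N -> val (s ^+ n * u) 0.
Proof.
case: n => // n uc _; rewrite -(mul0r (0 ^+ n * c)) exprS -mulrA.
by apply: valM => //; apply: valM => //; apply: valX.
Qed.

Lemma local_factor_le k l u c u' d :
  s ^ k * u = s ^ l * u' -> val u c -> c != 0 -> val u' d -> l <= k.
Proof.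
move=> e uc c0 ud; rewrite leNgt; apply/negP => lt.
have [n n0 ln] : exists2 n : nat, (0 < n)%N & l = k + n%:Z.
  by exists `|l - k|%N; lia.
have uE : u = s ^+ n * u'.
  apply: (mulfI (expfz_neq0 k s_neq0)).
  by rewrite e ln expfzDr // -exprnP mulrA.
have := val_fun uc; rewrite uE => /(_ 0 (val_pos ud n0)) c0'.
by rewrite c0' eqxx in c0.
Qed.

Lemma local_place : exists v, [/\ is_place iota v, v s = 1 &
  forall u c, val u c -> c != 0 -> v u = 0].
Proof.
(* The implication lets the choice function take an arbitrary value at [0]. *)
have ex f : exists k : int, f != 0 -> exists u c, [/\ f = s ^ k * u, val u c & c != 0].
  have [->|f0] := eqVneq f 0; first by exists 0.
  by have [k h] := local_factor f0; exists k.
have [v vP] := functional_choice _ ex.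
have vE f k u c : f = s ^ k * u -> val u c -> c != 0 -> v f = k.
  move=> fE uc c0; have f0 : f != 0 by rewrite fE mulf_neq0 ?expfz_neq0 ?(val_neq0 uc).
  have [u' [c' [fE' uc' c0']]] := vP f f0.
  have e : s ^ k * u = s ^ v f * u' by rewrite -fE.
  apply: le_anti; apply/andP; split; first exact: local_factor_le e uc c0 uc'.
  exact: local_factor_le (esym e) uc' c0' uc.
have s1 : v s = 1 by apply: (vE _ _ 1 1); rewrite ?expr1z ?mulr1 ?oner_neq0.
exists v; split=> //; last by move=> u c uc c0; apply: (vE _ _ u c); rewrite ?expr0z ?mul1r.
split=> [f g f0 g0|n f g f0 g0 fg0 nf ng|c c0|]; last by exists s.
- have [u [c [fE uc c0]]] := vP f f0; have [u' [c' [gE uc' c0']]] := vP g g0.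
  apply: (vE _ _ (u * u') (c * c')); [|exact: valM|exact: mulf_neq0].
  by rewrite expfzDr // {1}fE {1}gE; ring.
- have [u [c [fE uc c0]]] := vP f f0; have [u' [c' [gE uc' c0']]] := vP g g0.
  have [u2 [c2 [fgE uc2 c02]]] := vP _ fg0.
  have shift h k w d : h = s ^ k * w -> val w d -> n <= k ->
      exists w' d', h = s ^ n * w' /\ val w' d'.
    move=> hE wd nk; exists (s ^+ `|k - n|%N * w), (0 ^+ `|k - n|%N * d).
    split; last by apply: valM => //; apply: valX.
    by rewrite hE mulrA exprnP -expfzDr //; congr (s ^ _ * w); lia.
  have [w [d [fE' wd]]] := shift _ _ _ _ fE uc nf.
  have [w' [d' [gE' wd']]] := shift _ _ _ _ gE uc' ng.
  have e : s ^ v (f + g) * u2 = s ^ n * (w + w') by rewrite -fgE {1}fE' {1}gE' mulrDr.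
  exact: local_factor_le e uc2 c02 (valD wd wd').
- by apply: (vE _ _ (iota c) c) => //; rewrite expr0z mul1r.
Qed.

(** On [s ^ k * u] with [u] a unit, a place is [k] times its value at [s]. As some function has
    value [1], that positive factor must be [1]. *)
Lemma local_place_unique v w :
  is_place iota v -> is_place iota w ->
  (forall u c, val u c -> c != 0 -> v u = 0 /\ w u = 0) -> 0 < v s -> 0 < w s ->
  forall f, f != 0 -> v f = w f.
Proof.
move=> vP wP units vs ws.
have pw t k : is_place iota t -> t (s ^ k) = t s * k.
  move=> tP; case: k => k; first by rewrite -exprnP (placeX tP).
  by rewrite NegzE -exprnN (placeV tP) ?expf_neq0 // (placeX tP) //; lia.
have fac f : f != 0 -> exists k, v f = v s * k /\ w f = w s * k.
  move=> f0; have [k [u [c [fE uc c0]]]] := local_factor f0.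
  have [vu wu] := units u c uc c0; exists k.
  have u0 := val_neq0 uc c0.
  rewrite fE (placeM vP) ?(placeM wP) ?expfz_neq0 // vu wu !addr0.
  by rewrite !pw.
have norm t : is_place iota t -> (forall f, f != 0 -> exists k, t f = t s * k) ->
    0 < t s -> t s = 1.
  move=> tP tk t0; have [f [f0 tf]] := place1 tP; have [k] := tk f f0.
  rewrite {}tf; move: (t s) t0 => a a0 ak.
  have k0 : 0 < k by rewrite -(pmulr_rgt0 k a0) -ak.
  by apply/eqP; rewrite eq_le; apply/andP; split; [rewrite {1}ak ler_peMr|]; lia.
have v1 : v s = 1.
  by apply: norm vP _ vs => f f0; have [k []] := fac f f0; exists k.
have w1 : w s = 1.
  by apply: norm wP _ ws => f f0; have [k []] := fac f f0; exists k.
by move=> f f0; have [k [-> ->]] := fac f f0; rewrite v1 w1.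
Qed.

End LocalRing.

(** * Automorphisms acting on places *)

Lemma place_comp (K L : fieldType) (iota : {rmorphism K -> L}) v (s : {rmorphism L -> L}) :
  is_Kaut iota s -> is_place iota v -> is_place iota (v \o s).
Proof.
case=> _ _ _ [t ts st] sK vP; split=> [f g f0 g0|n f g f0 g0 fg0|c c0|] /=.
- by rewrite rmorphM (placeM vP) ?fmorph_eq0.
- by rewrite rmorphD => ? ?; apply: (placeD vP); rewrite -?rmorphD ?fmorph_eq0.
- by rewrite sK (placeC vP).
- have [f [f0 vf]] := place1 vP; exists (t f); rewrite st vf.
  by split=> //; rewrite -(fmorph_eq0 s) st.
Qed.

Lemma is_Kaut_rmorph (K L : fieldType) (iota : {rmorphism K -> L}) (s : {rmorphism L -> L}) :
  bijective s -> (forall c, s (iota c) = iota c) -> is_Kaut iota s.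
Proof. by split=> //; [apply: rmorphD | apply: rmorphM | apply: rmorph1]. Qed.

Lemma Kaut_rmorph (K L : fieldType) (iota : {rmorphism K -> L}) (s : L -> L) :
  is_Kaut iota s -> exists r : {rmorphism L -> L}, r =1 s.
Proof.
case=> sD sM s1 _ _.
have s0 : s 0 = 0 by apply: (addIr (s 0)); rewrite -sD !add0r.
have sB : zmod_morphism s.
  by move=> a b; apply/eqP; rewrite eq_sym subr_eq -sD subrK.
by exists (HB.pack_for {rmorphism L -> L} s (GRing.isZmodMorphism.Build L L s sB)
  (GRing.isMonoidMorphism.Build L L s (conj s1 sM))).
Qed.

Lemma Kaut_comp (K L : fieldType) (iota : {rmorphism K -> L}) (s t : L -> L) :
  is_Kaut iota s -> is_Kaut iota t -> is_Kaut iota (s \o t).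
Proof.
case=> sD sM s1 sb sK [tD tM t1 tb tK]; split=> /= [u v|u v|||c].
- by rewrite tD sD.
- by rewrite tM sM.
- by rewrite t1.
- exact: bij_comp.
- by rewrite tK.
Qed.

Lemma prim_root_exists (K : closedFieldType) n :
  n%:R != 0 :> K -> exists w : K, n.-primitive_root w.
Proof.
move=> n0; have n_gt0 : (0 < n)%N by case: n n0; rewrite ?eqxx.
have [r rE] := closed_field_poly_normal ('X^n - 1 : {poly K}).
have l1 : lead_coef ('X^n - 1 : {poly K}) = 1 by apply/monicP/monicXnsubC.
rewrite l1 scale1r in rE.
have sz : size r = n.
  by have := size_XnsubC (1 : K) n_gt0; rewrite polyC1 rE size_prod_XsubC => -[].
have /hasP[w _ wP] : has n.-primitive_root r.
  apply: has_prim_root => //; last by rewrite sz.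
    apply/allP => w wr; rewrite unity_rootE -subr_eq0.
    have : root ('X^n - 1) w by rewrite rE root_prod_XsubC.
    by rewrite rootE -polyC1 hornerD hornerN hornerXn hornerC.
  by rewrite -separable_prod_XsubC -rE separable_Xn_sub_1.
by exists w.
Qed.

Lemma Kaut_inverse (K L : fieldType) (iota : {rmorphism K -> L}) (s : {rmorphism L -> L}) :
  is_Kaut iota s ->
  exists t : {rmorphism L -> L}, [/\ is_Kaut iota t, cancel s t & cancel t s].
Proof.
case=> sD sM s1 [t ts st] sK.
have tK : is_Kaut iota t.
  split=> [a b|a b|||c]; last by rewrite -{1}sK ts.
  - by apply: (can_inj ts); rewrite sD !st.
  - by apply: (can_inj ts); rewrite sM !st.
  - by rewrite -{1}s1 ts.
  - by exists s.
have [r rE] := Kaut_rmorph tK; exists r; split=> [|u|u]; last by rewrite rE st.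
  apply: is_Kaut_rmorph; first by exists s => u; rewrite rE ?st ?ts.
  by move=> c; rewrite rE; case: tK.
by rewrite rE ts.
Qed.

Lemma dvdn_sub_add N i j : (i < N -> j < N -> N %| N - j + i -> i = j)%N.
Proof. by move=> iN jN /dvdnP[[|[|c]] cE]; nia. Qed.

(** Intended for [C = w y], [B = w (x - a)] and [A] the value of a denominator divisible by [x - a]:
    since [C * N <= B], a factor [y ^ j] with [j < N] cannot cancel the pole. *)
Lemma slope_contradiction (A B C : int) (N j : nat) : (j < N)%N ->
  C * N%:Z <= B -> B <= A -> 0 <= C -> 1 <= B -> 0 <= C * j%:Z - A -> False.
Proof.
move=> ltj CB BA C0 B1 h.
have : C * (j.+1)%:Z <= C * N%:Z by apply: ler_wpM2l; rewrite ?lez_nat.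
rewrite -addn1 PoszD mulrDr mulr1 => h2; have C1 : C = 0 by lia.
by move: h; rewrite C1 mul0r; lia.
Qed.

(* The form [D ^ 3 - A * B * C], its polarisation and its derivatives at a point, in
   the coordinates [(A, B, D, C)] indexed by [0, 1, 2, 3]. *)
Section CubicForm.
Variable K : fieldType.
Implicit Types p r t : nat -> K.

Definition cubic p : K := p 0%N * p 1%N * p 3%N - p 2%N ^+ 3.

Definition cubic_deriv p r : K :=
  p 1%N * p 3%N * r 0%N + p 0%N * p 3%N * r 1%N + p 0%N * p 1%N * r 3%N
  - 3 * p 2%N ^+ 2 * r 2%N.

Definition cubic_polar p r t : K :=
  p 0%N * r 1%N * t 3%N + p 0%N * t 1%N * r 3%N + r 0%N * p 1%N * t 3%N
  + r 0%N * t 1%N * p 3%N + t 0%N * p 1%N * r 3%N + t 0%N * r 1%N * p 3%N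
  - 6 * p 2%N * r 2%N * t 2%N.

End CubicForm.

Section CubicFormMorphism.
Variables (K L : fieldType) (f : {rmorphism K -> L}) (p r t : nat -> K).

Lemma rmorph_cubic : f (cubic p) = cubic (f \o p).
Proof. by rewrite /cubic rmorphB rmorphXn !rmorphM. Qed.

Lemma rmorph_cubic_deriv : f (cubic_deriv p r) = cubic_deriv (f \o p) (f \o r).
Proof. by rewrite /cubic_deriv rmorphB !rmorphD !rmorphM rmorph_nat. Qed.

Lemma rmorph_cubic_polar :
  f (cubic_polar p r t) = cubic_polar (f \o p) (f \o r) (f \o t).
Proof. by rewrite /cubic_polar rmorphB !rmorphD !rmorphM rmorph_nat. Qed.

End CubicFormMorphism.

(** * The function field of the curve *)

Section FunctionField.
Variables (K : closedFieldType) (L : fieldType) (iota : {rmorphism K -> L}) (m : nat).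
Hypotheses (m_ge4 : (4 <= m)%N) (m3 : (3 * m)%:R = 1 :> K).
Variables x y : L.
Hypotheses (xT : transcendental iota x) (xy : on_curve m x y).
Hypothesis gen : forall z : L, exists P Q : {poly {poly K}},
  ev2 iota Q x y != 0 /\ z = ev2 iota P x y / ev2 iota Q x y.

Local Notation z := (y ^+ 3 / x).

Let m_gt0 : (0 < m)%N. Proof. exact: leq_trans m_ge4. Qed.

Lemma x_neq c : x != iota c.
Proof. by apply/eqP; apply: transcendental_neq. Qed.

Lemma x_neq0 : x != 0. Proof. by rewrite -(rmorph0 iota) x_neq. Qed.

Lemma poly_x_neq0 (p : {poly K}) : p != 0 -> (map_poly iota p).[x] != 0.
Proof. by move=> p0; apply: contraNneq p0 => /xT ->. Qed.

Lemma xm1_neq0 : x ^+ m + 1 != 0.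
Proof.
have -> : x ^+ m + 1 = (map_poly iota ('X^m + 1)).[x].
  by rewrite rmorphD /= map_polyXn rmorph1 hornerD hornerXn hornerC.
by apply: poly_x_neq0; rewrite -size_poly_eq0 size_polyDl size_polyXn ?size_poly1.
Qed.

Lemma curve_xy : y ^+ (3 * m) = - (x ^+ m * (x ^+ m + 1)).
Proof.
apply/eqP; rewrite -addr_eq0 mulrDr mulr1 -exprD addnn -mul2n.
by apply/eqP; exact: xy.
Qed.

Lemma y_neq0 : y != 0.
Proof.
have : y ^+ (3 * m) != 0.
  by rewrite curve_xy oppr_eq0 mulf_neq0 ?xm1_neq0 ?expf_neq0 ?x_neq0.
by rewrite expf_eq0 muln_gt0 m_gt0.
Qed.

Lemma z_neq0 : z != 0.
Proof. by rewrite mulf_neq0 ?invr_neq0 ?expf_neq0 ?x_neq0 ?y_neq0. Qed.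

Lemma xzE : x * z = y ^+ 3.
Proof. by rewrite mulrC divfK ?x_neq0. Qed.

Lemma curve_xz : 1 + x ^+ m + z ^+ m = 0.
Proof.
have xm : x ^+ m != 0 by rewrite expf_neq0 ?x_neq0.
have e : x ^+ m * z ^+ m = - (x ^+ m * (x ^+ m + 1)).
  by rewrite -curve_xy -exprMn xzE exprM.
by apply: (mulfI xm); rewrite mulr0 mulrDr e; ring.
Qed.

Lemma y_neq c : y != iota c.
Proof.
apply/eqP => yc; have : (map_poly iota ('X^(2 * m) + ('X^m + (c ^+ (3 * m))%:P))).[x] = 0.
  rewrite !rmorphD /= !map_polyXn map_polyC !hornerD !hornerXn hornerC /= rmorphXn -yc.
  by rewrite addrA addrC; exact: xy.
apply/eqP; apply: poly_x_neq0; rewrite -size_poly_eq0 size_polyDl size_polyXn // ltnS.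
rewrite (leq_trans (size_polyD _ _)) // geq_max size_polyXn.
rewrite (leq_trans (size_polyC_leq1 _)) ?muln_gt0 //.
by rewrite mul2n -addnn -addn1 leq_add2l m_gt0.
Qed.

(** * Diagonal automorphisms and permutations of the coordinates *)

Lemma theta_delta_exists delta : delta ^+ (3 * m) = 1 :> K ->
  exists s : {rmorphism L -> L}, [/\ is_Kaut iota s, s x = x & s y = iota delta * y].
Proof.
move=> d1; have d0 : delta != 0.
  by apply: contra_eqN d1 => /eqP->; rewrite expr0n muln_eq0 /= (gtn_eqF m_gt0) eq_sym oner_eq0.
have on e : e ^+ (3 * m) = 1 -> on_curve m x (iota e * y).
  by move=> e1; rewrite /on_curve exprMn -rmorphXn e1 rmorph1 mul1r; exact: xy.
have [s [sK sx sy]] := substitution m_ge4 m3 xT xy gen xT (on _ d1).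
have d1' : delta^-1 ^+ (3 * m) = 1 by rewrite exprVn d1 invr1.
have [t [tK tx ty]] := substitution m_ge4 m3 xT xy gen xT (on _ d1').
exists s; split=> //; apply: is_Kaut_rmorph => //; exists t.
  apply: (rmorph_ext gen (r := t \o s) (s := idfun)) => [c||] /=.
  - by rewrite sK tK.
  - by rewrite sx tx.
  - by rewrite sy rmorphM tK ty fmorphV mulVKf // fmorph_eq0.
apply: (rmorph_ext gen (r := s \o t) (s := idfun)) => [c||] /=.
- by rewrite tK sK.
- by rewrite tx sx.
- by rewrite ty rmorphM sK sy fmorphV mulKf // fmorph_eq0.
Qed.

(** In the coordinates [(1 : x : y : z)] this is the exchange of [1] and [x], an involution. *)
Lemma theta2_exists : exists s : {rmorphism L -> L},
  [/\ is_Kaut iota s, s x = x^-1 & s y = y / x].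
Proof.
have x0 := x_neq0; have xm : x ^+ m != 0 by rewrite expf_neq0.
have xT' : transcendental iota x^-1.
  apply: transcendentalP => c e; have /eqP := x_neq c^-1; apply.
  by rewrite fmorphV -e invrK.
have on : on_curve m x^-1 (y / x).
  rewrite /on_curve expr_div_n curve_xy !exprVn mulnC exprM mul2n -addnn exprD.
  by field.
have [s [sK sx sy]] := substitution m_ge4 m3 xT xy gen xT' on.
have ss : cancel s s.
  apply: (rmorph_ext gen (r := s \o s) (s := idfun)) => [c||] /=.
  - by rewrite ?sK.
  - by rewrite sx fmorphV sx invrK. 
  - by rewrite sy fmorph_div sy sx; field; rewrite x0 oner_neq0.
by exists s; split=> //; apply: is_Kaut_rmorph => //; exists s.
Qed.

(** In the coordinates [(1 : x : y : z)] this is the cycle [1 -> x -> z -> 1]; the inverse is its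
    square. *)
Lemma theta3_exists : exists s : {rmorphism L -> L},
  [/\ is_Kaut iota s, s x = z / x & s y = y / x].
Proof.
have x0 := x_neq0; have y0 := y_neq0; have xm : x ^+ m != 0 by rewrite expf_neq0.
have xT' : transcendental iota (z / x).
  (* If [z = c x], then [1 + (1 + c ^ m) x ^ m = 0], a polynomial in [x] with constant coefficient
     [1]. *)
  apply: transcendentalP => c e.
  have zE : z = iota c * x by rewrite -e divfK.
  have := curve_xz; rewrite zE exprMn -rmorphXn => e2.
  have : (map_poly iota ('X^m + (c ^+ m)%:P * 'X^m + 1)).[x] = 0.
    rewrite !rmorphD rmorphM /= map_polyXn map_polyC rmorph1 !hornerD hornerM.
    by rewrite hornerXn !hornerC /= -[RHS]e2; ring.
  move/xT/polyP => /(_ 0%N); rewrite !coefD coefCM !coefXn coef1 coef0 /=.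
  by rewrite eq_sym (gtn_eqF m_gt0) mulr0 !add0r => /eqP; rewrite oner_eq0.
have on : on_curve m (z / x) (y / x).
  have zm : z ^+ m = - (1 + x ^+ m).
    by apply/eqP; rewrite -addr_eq0 addrC curve_xz.
  have e2 u : u ^+ (2 * m) = (u ^+ m) ^+ 2 :> L by rewrite mulnC exprM.
  have e3 u : u ^+ (3 * m) = (u ^+ m) ^+ 3 :> L by rewrite mulnC exprM.
  rewrite /on_curve e2 [(z / x) ^+ m]expr_div_n zm expr_div_n curve_xy e3.
  by field.
have [s [sK sx sy]] := substitution m_ge4 m3 xT xy gen xT' on.
have s3 u : s (s (s u)) = u.
  apply: (rmorph_ext gen (r := s \o (s \o s)) (s := idfun)) => [c||] /=.
  - by rewrite ?sK.
  - rewrite sx !(fmorph_div, rmorphXn) sx sy !(fmorph_div, rmorphXn) sx sy.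
    by field; rewrite x0 y0.
  - rewrite sy fmorph_div sx sy !(fmorph_div, rmorphXn) sx sy.
    by field; rewrite x0 y0.
exists s; split=> //; apply: is_Kaut_rmorph => //.
by exists (s \o s) => u /=; rewrite s3.
Qed.

Lemma xm1E : x ^+ m + 1 = (map_poly iota ('X^m + 1)).[x].
Proof. by rewrite rmorphD /= map_polyXn rmorph1 hornerD hornerXn hornerC. Qed.

Lemma xm1_simple_root (a : K) : a != 0 -> ('X^m + 1).[a] = 0 ->
  exists h, 'X^m + 1 = h * ('X - a%:P) /\ h.[a] != 0.
Proof.
move=> a0 /eqP/factor_theorem [h hE]; exists h; split=> //.
have := congr1 (fun p => p^`().[a]) hE.
rewrite derivM derivXsubC mulr1 derivD derivXn -polyC1 derivC addr0.
rewrite hornerD hornerM hornerXsubC subrr mulr0 add0r hornerMn hornerXn => <-.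
by rewrite -mulr_natr mulf_neq0 ?expf_neq0 // (m_neq0 m3).
Qed.

(** * Values of [x], [y], [z] at a place, and centres *)

Section PlaceFacts.
Variable w : L -> int.
Hypothesis wP : is_place iota w.

Lemma place_curve : w y * (3 * m)%:Z = w x * m%:Z + w (x ^+ m + 1).
Proof.
rewrite -(placeX wP) ?y_neq0 // curve_xy (placeN wP) (placeM wP) ?xm1_neq0 //.
  by rewrite (placeX wP) ?x_neq0.
by rewrite expf_neq0 ?x_neq0.
Qed.

Lemma place_z : w z = w y * 3 - w x.
Proof. by rewrite (place_div wP) ?expf_neq0 ?x_neq0 ?y_neq0 // (placeX wP) ?y_neq0. Qed.

Lemma size_xm1 : size ('X^m + 1 : {poly K}) = m.+1.
Proof. by rewrite size_polyDl size_polyXn ?size_poly1 // ltnS. Qed.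

Lemma place_x_neg : w x < 0 -> w y * 3 = w x * 2.
Proof.
move=> wx; have p0 : ('X^m + 1 : {poly K}) != 0 by rewrite -size_poly_eq0 size_xm1.
have [] := place_horner_pole wP x_neq0 wx p0; rewrite -xm1E size_xm1 => e _.
by have := place_curve; rewrite e /=; nia.
Qed.

(** If [a ^ m] is not [-1], then [x ^ m + 1] is a unit and [w y = 0]. Otherwise [x - a] is a simple
    factor of [x ^ m + 1], and equality holds. *)
Lemma place_center a : vge w 1 (x - iota a) -> a != 0 ->
  w x = 0 /\ w y * (3 * m)%:Z <= w (x - iota a).
Proof.
move=> wa a0; have wxa : 1 <= w (x - iota a) by apply: vgeE wa; rewrite subr_eq0 x_neq.
have wx : w x = 0.
  have := @place_horner_unit _ _ _ _ wP x a 'X wa; rewrite map_polyX !hornerX.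
  by case.
split=> //; rewrite place_curve wx mul0r add0r.
have [ra|ra] := eqVneq ('X^m + 1).[a] 0; last first.
  have [] := place_horner_unit wP wa ra; rewrite -xm1E => -> _.
  exact: le_trans wxa.
have [h [hE ha]] := xm1_simple_root a0 ra.
have [hw h0] := place_horner_unit wP wa ha.
rewrite xm1E hE rmorphM rmorphB /= map_polyX map_polyC hornerM hornerXsubC.
by rewrite (placeM wP) ?hw ?add0r // subr_eq0 x_neq.
Qed.

Lemma place_x_pos : 0 < w x -> w y * 3 = w x.
Proof.
move=> wx; have w0 : vge w 1 (x - iota 0) by rewrite rmorph0 subr0; right.
have h0 : ('X^m + 1 : {poly K}).[0] != 0.
  by rewrite hornerD hornerXn hornerC expr0n (gtn_eqF m_gt0) add0r oner_neq0.
have [h _] := place_horner_unit wP w0 h0.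
by have := place_curve; rewrite xm1E h; nia.
Qed.

Lemma place_y_ge0 : 0 <= w x -> 0 <= w y.
Proof.
move=> wx; have : vge w 0 (x ^+ m + 1) by rewrite xm1E; apply: vge_horner => //; right.
move/(vgeE xm1_neq0); have := place_curve; nia.
Qed.

Lemma vge_ev2 P : 0 <= w x -> vge w 0 (ev2 iota P x y).
Proof.
move=> wx; rewrite ev2_coef; apply: (vge_sum wP) => i _.
rewrite -[0]addr0; apply: (vgeM wP); first by apply: vge_horner => //; right.
by rewrite -(mul0r i%:Z); apply: (vgeX wP); right; apply: place_y_ge0.
Qed.

(** A function of value [1] has a numerator of positive value, and a multiple of this numerator is a
    polynomial in [x]. One of the roots of that polynomial is the centre. *)
Lemma center_exists : 0 <= w x -> exists a, vge w 1 (x - iota a).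
Proof.
move=> wx; have [u [u0 wu]] := place1 wP.
have [P [r [_ r0 uE]]] := basis_representation m_ge4 xT xy gen u.
have R0 := poly_x_neq0 r0.
have P0 : ev2 iota P x y != 0 by apply: contraNneq u0 => P0; rewrite uE P0 mul0r.
have [C [r' [r'0 PC]]] := ev2_multiple_in_x m_ge4 xy P0.
apply: (place_poly_root wP _ x_neq r'0); first by right.
rewrite -PC -[1]addr0; apply: (vgeM wP); last exact: vge_ev2.
right; rewrite -[ev2 _ _ _ _](divfK R0) -uE (placeM wP) // wu.
have : vge w 0 (map_poly iota r).[x] by apply: vge_horner => //; right.
by move/(vgeE R0); lia.
Qed.

Lemma center_y_exists a : vge w 1 (x - iota a) -> exists b,
  vge w 1 (y - iota b) /\ on_curve m a b.
Proof.
move=> wa; have wx : 0 <= w x.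
  apply: (vgeE x_neq0); rewrite -[x](subrK (iota a)); apply: (vgeD wP).
    exact: vge_le wa.
  exact: vge_const.
pose q : {poly K} := 'X^(2 * m) + 'X^m; pose p := 'X^(3 * m) + (q.[a])%:P.
have sp : size p = (3 * m).+1.
  by rewrite size_polyDl size_polyXn // (leq_ltn_trans (size_polyC_leq1 _)) // ltnS muln_gt0.
have pE t : (map_poly iota p).[t] = t ^+ (3 * m) + iota q.[a].
  by rewrite rmorphD /= map_polyXn map_polyC hornerD hornerXn hornerC.
have wp : vge w 1 (map_poly iota p).[y].
  have -> : (map_poly iota p).[y] = - ((map_poly iota q).[x] - iota q.[a]).
    have -> : (map_poly iota q).[x] = x ^+ (2 * m) + x ^+ m.
      by rewrite rmorphD /= !map_polyXn hornerD !hornerXn.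
    have := xy; rewrite /on_curve pE => /eqP; rewrite addr_eq0 => /eqP ->.
    by rewrite opprB addrC.
  by apply: (vgeN wP); apply: place_horner_center.
have [|||b wb] := place_poly_root wP _ _ _ wp.
- by right; apply: place_y_ge0.
- exact: y_neq.
- by rewrite -size_poly_eq0 sp.
exists b; split=> //.
have h : vge w 1 (iota p.[b]).
  have -> : iota p.[b] = (map_poly iota p).[y] - ((map_poly iota p).[y] - iota p.[b]).
    by ring.
  by apply: (vgeB wP) => //; apply: place_horner_center.
have : p.[b] = 0.
  apply/eqP; apply: contraT => pb; have := vgeE _ h.
  by rewrite fmorph_eq0 pb (placeC wP) // => /(_ isT).
by rewrite /p /q !(hornerD, hornerXn, hornerC).
Qed.

End PlaceFacts.

(** * The place at an affine point with nonzero first coordinate *)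

Section LocalPoint.
Variables a b : K.
Hypotheses (a_neq0 : a != 0) (ab : on_curve m a b).

Local Notation evK P := (ev2 (idfun : {rmorphism K -> K}) P a b).

(** The local ring at [(a, b)] together with its residue map, encoded as a relation so that no
    representation of [u] has to be chosen. *)
Definition regular_value (u : L) (c : K) : Prop := exists P Q : {poly {poly K}},
  [/\ evK Q != 0, u = ev2 iota P x y / ev2 iota Q x y & c = evK P / evK Q].

Local Notation val := regular_value.

Let ev_neq0 Q : evK Q != 0 -> ev2 iota Q x y != 0.
Proof.
apply: contraNneq => h; apply/eqP.
exact: (ev2_kernel m_ge4 m3 xT xy (idfun : {rmorphism K -> K}) ab h).
Qed.

Let val_fun u c d : val u c -> val u d -> c = d.
Proof.
case=> P [Q [Q0 -> ->]] [P' [Q' [Q'0 e ->]]].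
have : ev2 iota (P * Q' - P' * Q) x y = 0.
  move/eqP: e; rewrite eqr_div ?ev_neq0 // => /eqP e.
  by rewrite ev2B !ev2M e subrr.
move/(ev2_kernel m_ge4 m3 xT xy (idfun : {rmorphism K -> K}) ab).
by rewrite ev2B !ev2M => /eqP; rewrite subr_eq0 -eqr_div // => /eqP.
Qed.

Let val_ev P : val (ev2 iota P x y) (evK P).
Proof. by exists P, 1; rewrite !ev2_1 !divr1 oner_neq0. Qed.

Let val_const c : val (iota c) c.
Proof. by have := val_ev c%:P%:P; rewrite !ev2CC. Qed.

Let valD u c u' c' : val u c -> val u' c' -> val (u + u') (c + c').
Proof.
case=> P [Q [Q0 -> ->]] [P' [Q' [Q'0 -> ->]]].
exists (P * Q' + P' * Q), (Q * Q').
by rewrite !(ev2D, ev2M) mulf_neq0 // !addf_div ?ev_neq0.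
Qed.

Let valM u c u' c' : val u c -> val u' c' -> val (u * u') (c * c').
Proof.
case=> P [Q [Q0 -> ->]] [P' [Q' [Q'0 -> ->]]].
by exists (P * P'), (Q * Q'); rewrite !ev2M mulf_neq0 // !mulf_div.
Qed.

Let valV u c : val u c -> c != 0 -> val u^-1 c^-1.
Proof.
case=> P [Q [Q0 -> ->]]; rewrite mulf_eq0 negb_or => /andP[P0 _].
by exists Q, P; rewrite !invf_div.
Qed.

Let val_frac f : exists u c u' c', [/\ val u c, val u' c', u' != 0 & f = u / u'].
Proof.
have [P [Q [Q0 ->]]] := gen f.
by exists (ev2 iota P x y), (evK P), (ev2 iota Q x y), (evK Q); split.
Qed.

Let val_x (p : {poly K}) : val (map_poly iota p).[x] p.[a].
Proof. by have := val_ev p%:P; rewrite !ev2C map_poly_id. Qed.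

Let ev2_in_y (M : fieldType) (j : {rmorphism K -> M}) (g : {poly K}) t u :
  ev2 j (map_poly polyC g) t u = (map_poly j g).[u].
Proof.
elim/poly_ind: g => [|g c IH]; first by rewrite !rmorph0 horner0 ev2_0.
rewrite !rmorphD !rmorphM /= !map_polyX !map_polyC /= ev2D ev2M IH ev2Y ev2CC.
by rewrite hornerMXaddC.
Qed.

Let val_y (p : {poly K}) : val (map_poly iota p).[y] p.[b].
Proof. by have := val_ev (map_poly polyC p); rewrite !ev2_in_y map_poly_id. Qed.

Let valX u c n : val u c -> val (u ^+ n) (c ^+ n).
Proof.
move=> h; elim: n => [|n IH]; last by rewrite !exprS; apply: valM.
by rewrite !expr0 -(rmorph1 iota).
Qed.

Let val_id_x : val x a. Proof. by have := val_x 'X; rewrite map_polyX !hornerX. Qed.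
Let val_id_y : val y b. Proof. by have := val_y 'X; rewrite map_polyX !hornerX. Qed.

Let valN u c : val u c -> val (- u) (- c).
Proof. by move=> h; have := valM (val_const (-1)) h; rewrite rmorphN rmorph1 !mulN1r. Qed.

(** If [b = 0], then [x - a] is [y ^ (3 * m)] times a unit and [y] is a uniformizer; otherwise
    [x - a] is one. The last clause, with exponent [3 * m] or [1], later bounds divisibility by
    [s]. *)
Lemma uniformizer_exists : exists s,
  [/\ s != 0, val s 0, b = 0 -> s = y,
      (exists c, val ((x - iota a) / s) c) /\ (exists c, val ((y - iota b) / s) c) &
      exists e u c, [/\ x - iota a = s ^+ e * u, val u c & c != 0]].
Proof.
have [b0|b0] := eqVneq b 0.
  have am : a ^+ m = -1.
    have am0 : a ^+ m != 0 by rewrite expf_neq0.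
    have := ab; rewrite /on_curve b0 expr0n muln_eq0 /= (gtn_eqF m_gt0) add0r.
    rewrite mul2n -addnn exprD -{3}[a ^+ m]mulr1 -mulrDr => /eqP.
    by rewrite mulf_eq0 (negPf am0) addr_eq0 => /eqP.
  have [|h [hE ha]] := xm1_simple_root a_neq0.
    by rewrite -polyC1 hornerD hornerXn hornerC am addNr.
  have hx : (map_poly iota h).[x] != 0.
    by apply: poly_x_neq0; apply: contraNneq ha => ->; rewrite horner0.
  have xaE : x - iota a = y ^+ (3 * m) * - (x ^+ m * (map_poly iota h).[x])^-1.
    rewrite curve_xy xm1E hE rmorphM rmorphB /= map_polyX map_polyC hornerM hornerXsubC.
    by field; rewrite hx expf_neq0 ?x_neq0.
  have vu : val (- (x ^+ m * (map_poly iota h).[x])^-1) (- (a ^+ m * h.[a])^-1).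
    apply/valN/valV; last by rewrite mulf_neq0 // expf_neq0.
    by apply: valM => //; apply: valX.
  exists y; split; rewrite ?y_neq0 //; first by rewrite -b0.
    split; last by exists 1; rewrite b0 rmorph0 subr0 divff ?y_neq0 // -(rmorph1 iota).
    have [k kE] : exists k, (3 * m)%N = k.+1 by exists (3 * m).-1; rewrite prednK ?muln_gt0.
    exists (b ^+ k * - (a ^+ m * h.[a])^-1).
    rewrite xaE kE exprS -[X in X / y]mulrA [X in X / y]mulrC mulfK ?y_neq0 //.
    by apply: valM => //; apply: valX.
  exists (3 * m)%N, (- (x ^+ m * (map_poly iota h).[x])^-1), (- (a ^+ m * h.[a])^-1).
  by split=> //; rewrite oppr_eq0 invr_neq0 // mulf_neq0 // expf_neq0.
have xa0 : x - iota a != 0 by rewrite subr_eq0 x_neq.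
exists (x - iota a); split=> //.
- rewrite -(subrr a); apply: valD => //.
  by rewrite -rmorphN.
- by move=> b0'; rewrite b0' eqxx in b0.
- split; first by exists 1; rewrite divff // -(rmorph1 iota).
  pose q : {poly K} := 'X^(2 * m) + 'X^m.
  have /factor_theorem [h hE] : root (q - q.[a]%:P) a.
    by rewrite rootE hornerD hornerN hornerC subrr.
  have /factor_theorem [g gE] : root ('X^(3 * m) - (b ^+ (3 * m))%:P) b.
    by rewrite rootE hornerD hornerN hornerXn hornerC subrr.
  (* [g.[b]] is the derivative [3 m b ^ (3 m - 1)], nonzero because [3 m = 1] in [K]. *)
  have gb : g.[b] != 0.
    have := congr1 (fun p => p^`().[b]) gE.
    rewrite derivM derivXsubC mulr1 derivB derivXn derivC subr0.
    rewrite hornerD hornerM hornerXsubC subrr mulr0 add0r hornerMn hornerXn => <-.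
    by rewrite -mulr_natr m3 mulr1 expf_neq0.
  have gy : (map_poly iota g).[y] != 0.
    apply: contraNneq gb => gy; apply/eqP; apply: val_fun (val_y g) _.
    by rewrite gy -(rmorph0 iota).
  exists (- h.[a] / g.[b]).
  (* Subtracting the equations at [(x, y)] and [(a, b)] gives [(y - b) g(y) = - (x - a) h(x)]. *)
  have -> : (y - iota b) / (x - iota a) =
      - (map_poly iota h).[x] / (map_poly iota g).[y].
    apply/eqP; rewrite eqr_div //; apply/eqP.
    have hx := congr1 (fun p => (map_poly iota p).[x]) hE.
    have gx := congr1 (fun p => (map_poly iota p).[y]) gE.
    rewrite /q !rmorphM !rmorphB !rmorphD /= !map_polyXn map_polyX !map_polyC in hx.
    rewrite !rmorphM !rmorphB /= !map_polyXn map_polyX !map_polyC in gx.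
    rewrite !(hornerD, hornerN, hornerM, hornerXn, hornerX, hornerC) /= in hx gx.
    have := xy; have := ab; rewrite /on_curve => /(congr1 iota).
    rewrite rmorph0 !rmorphD /= => e1 e2.
    rewrite [LHS]mulrC -gx mulNr -hx rmorphD.
    by apply/eqP; rewrite -subr_eq0 opprK -[X in _ == X](subrr 0) -{1}e2 -e1; apply/eqP; ring.
  by apply: valM; [apply: valN | apply: valV].
- exists 1%N, 1, 1; rewrite expr1 mulr1 oner_neq0; split=> //.
  by rewrite -(rmorph1 iota).
Qed.

Let taylor P : exists (A : {poly K}) B, P = B * ('X - b%:P%:P) +
  ((A * ('X - a%:P))%:P + (evK P)%:P%:P).
Proof.
have [B BE] : exists B, P - (P.[b%:P])%:P = B * ('X - b%:P%:P).
  by apply/factor_theorem; rewrite rootE hornerD hornerN hornerC subrr.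
have [A AE] : exists A, P.[b%:P] - (evK P)%:P = A * ('X - a%:P).
  apply/factor_theorem; rewrite rootE hornerD hornerN hornerC /ev2.
  have -> : map_poly (map_poly (idfun : {rmorphism K -> K})) P = P.
    by apply: map_poly_id => p _; apply: map_poly_id.
  by rewrite subrr.
by exists A, B; rewrite -BE -AE polyCB subrK subrK.
Qed.

Let ev2_taylor P : exists (A : {poly K}) B, ev2 iota P x y =
  ev2 iota B x y * (y - iota b) + ((map_poly iota A).[x] * (x - iota a) + iota (evK P)).
Proof.
have [A [B PE]] := taylor P; exists A, B; rewrite {1}PE.
rewrite !ev2D ev2M ev2B ev2Y !ev2CC ev2C rmorphM rmorphB /= map_polyX map_polyC.
by rewrite hornerM hornerXsubC.
Qed.

Let val_divs s cx cy u : val ((x - iota a) / s) cx -> val ((y - iota b) / s) cy ->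
  val u 0 -> exists c, val (u / s) c.
Proof.
move=> vx vy [P [Q [Q0 uE /esym/eqP]]].
rewrite mulf_eq0 invr_eq0 (negPf Q0) orbF => /eqP P0.
have [A [B PE]] := ev2_taylor P; rewrite P0 rmorph0 addr0 in PE.
exists ((evK B * cy + A.[a] * cx) * (evK Q)^-1).
have -> : u / s = (ev2 iota B x y * ((y - iota b) / s) +
    (map_poly iota A).[x] * ((x - iota a) / s)) * (ev2 iota Q x y)^-1.
  by rewrite uE PE; ring.
by apply: valM; [apply: valD; apply: valM | apply: valV].
Qed.

(** A multiple of the numerator of [u] is a polynomial in [x], say [(x - a) ^ k r'] with [r']
    nonzero at [a]. As [x - a] is [s ^ e] times a unit, [N = e k + 1] suffices. *)
Let val_bound s e u1 c1 : s != 0 -> val s 0 -> x - iota a = s ^+ e * u1 -> val u1 c1 ->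
  c1 != 0 -> forall u c, val u c -> u != 0 -> exists N, forall d, ~ val (u / s ^+ N) d.
Proof.
move=> s0 vs xaE vu1 c10 u c [P [Q [Q0 uE _]]] u0.
have eQ := ev_neq0 Q0.
have eP : ev2 iota P x y != 0 by apply: contraNneq u0 => h; rewrite uE h mul0r.
have [C [r [r0 PC]]] := ev2_multiple_in_x m_ge4 xy eP.
have [k [r' nr rE]] := multiplicity_XsubC r a.
rewrite r0 /= in nr; exists (e * k).+1 => d vd.
have h : (map_poly iota r').[x] * u1 ^+ k =
    u / s ^+ (e * k).+1 * (ev2 iota Q x y * ev2 iota C x y) * s.
  have e1 : u * (ev2 iota Q x y * ev2 iota C x y) =
      (map_poly iota r').[x] * (s ^+ (e * k) * u1 ^+ k).
    rewrite uE mulrA divfK // PC rE rmorphM rmorphXn rmorphB /= map_polyX map_polyC.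
    by rewrite hornerM horner_exp hornerXsubC /= xaE exprMn exprM.
  apply: (mulfI (expf_neq0 (e * k) s0)).
  rewrite mulrCA -e1 exprS; field.
  by rewrite expf_neq0.
have v1 : val ((map_poly iota r').[x] * u1 ^+ k) (r'.[a] * c1 ^+ k).
  by apply: valM => //; apply: valX.
have v2 := valM (valM vd (valM (val_ev Q) (val_ev C))) vs.
rewrite h in v1; have := val_fun v1 v2; rewrite mulr0 => /eqP.
by rewrite mulf_eq0 expf_eq0 (negPf c10) andbF orbF => ra; move: nr; rewrite rootE ra.
Qed.

Let unit_center w u c : is_place iota w -> vge w 1 (x - iota a) -> vge w 1 (y - iota b) ->
  val u c -> c != 0 -> w u = 0.
Proof.
move=> wP wa wb.
have wx : 0 <= w x.
  apply: (vgeE x_neq0); rewrite -[x](subrK (iota a)); apply: (vgeD wP).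
    exact: vge_le wa.
  exact: vge_const.
have ctr P : evK P != 0 -> w (ev2 iota P x y) = 0.
  move=> P0; have [A [B ->]] := ev2_taylor P; rewrite addrA addrC.
  have i0 : iota (evK P) != 0 by rewrite fmorph_eq0.
  set g := (X in iota _ + X).
  suff g1 : vge w 1 g.
    have [|-> _] := place_dominant wP i0 (g := g); last by rewrite (placeC wP).
    by rewrite (placeC wP) // add0r.
  rewrite /g; apply: (vgeD wP); rewrite -[1]add0r.
    by apply: (vgeM wP) => //; apply: vge_ev2.
  by apply: (vgeM wP) => //; apply: vge_horner => //; right.
case=> P [Q [Q0 -> ->]]; rewrite mulf_eq0 invr_eq0 (negPf Q0) orbF => P0.
by rewrite (place_div wP) ?ev_neq0 // !ctr.
Qed.

Lemma place_at_exists : exists w,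
  [/\ is_place iota w, vge w 1 (x - iota a) & b = 0 -> w y = 1].
Proof.
have [s [s0 vs sy [[cx vx] [cy vy]] [e [u [c [xaE uc c0]]]]]] := uniformizer_exists.
have [w [wP ws wu]] := local_place val_fun val_const valD valM valV val_frac s0 vs
  (fun u => val_divs vx vy) (val_bound s0 vs xaE uc c0).
exists w; split=> //; last by move/sy => <-.
rewrite -[x - iota a](divfK s0) -[1]add0r; apply: (vgeM wP); last by right; rewrite ws.
have [cx0|cx0] := eqVneq cx 0; last by right; rewrite (wu _ _ vx cx0).
(* [local_place] only speaks of units; a regular function vanishing at the point becomes a unit
   after subtracting [1]. *)
rewrite -[_ / s](subrK (iota 1)); apply: (vgeD wP); last exact: vge_const.
have v1 := valD vx (valN (val_const 1)).
by right; rewrite (wu _ _ v1) // cx0 add0r oppr_eq0 oner_neq0.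
Qed.

Lemma place_at_unique v w : b = 0 -> is_place iota v -> is_place iota w ->
  vge v 1 (x - iota a) -> vge w 1 (x - iota a) -> forall f, f != 0 -> v f = w f.
Proof.
move=> b0 vP wP va wa.
have [s [s0 vs /(_ b0) sy [[cx vx] [cy vy]] [e [u [c [xaE uc c0]]]]]] := uniformizer_exists.
have ctr t : is_place iota t -> vge t 1 (x - iota a) -> vge t 1 (y - iota b).
  move=> tP ta; have [b' [tb' ab']] := center_y_exists tP ta.
  (* The fibre over [a] consists of [(a, 0)] alone, so every place centred at [x = a] is centred
     there. *)
  have b'0 : b' ^+ (3 * m) = 0.
    by move: ab ab'; rewrite /on_curve b0 expr0n muln_eq0 /= (gtn_eqF m_gt0) add0r => ->; rewrite addr0.
  by move/eqP: b'0; rewrite expf_eq0 => /andP[_ /eqP b'0]; rewrite b0 -b'0.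
have y_pos t : is_place iota t -> vge t 1 (x - iota a) -> 0 < t s.
  move=> tP ta; have := ctr t tP ta; rewrite b0 rmorph0 subr0 sy => /(vgeE y_neq0).
  exact: lt_le_trans.
apply: (local_place_unique val_fun val_const valM valV val_frac s0
  (fun u => val_divs vx vy) (val_bound s0 vs xaE uc c0)) => //; last 2 first.
- exact: y_pos.
- exact: y_pos.
by move=> t d td d0; rewrite !(unit_center _ _ _ td d0) //; apply: ctr.
Qed.

End LocalPoint.

Lemma curve_point_exists (a : K) : exists b, on_curve m a b.
Proof.
pose c := a ^+ (2 * m) + a ^+ m.
have /closed_rootP [b] : size ('X^(3 * m) + c%:P) != 1%N.
  rewrite size_polyDl size_polyXn; first by rewrite eqSS gtn_eqF // muln_gt0.
  by rewrite (leq_ltn_trans (size_polyC_leq1 _)) // ltnS muln_gt0.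
by rewrite rootE hornerD hornerXn hornerC => /eqP; exists b.
Qed.

Lemma place_over a : a != 0 -> exists w, is_place iota w /\ vge w 1 (x - iota a).
Proof.
move=> a0; have [b ab] := curve_point_exists a.
by have [w []] := place_at_exists a0 ab; exists w.
Qed.

(** * Coordinate exchanges and the places over [x = 0] and [x = oo] *)

Lemma rho1_exists : exists s : {rmorphism L -> L},
  [/\ is_Kaut iota s, s x = z & s y = y].
Proof.
have [s [sK sx sy]] := theta2_exists; have [t [tK tx ty]] := theta3_exists.
have x0 := x_neq0; have y0 := y_neq0.
exists (s \o t); split=> /=; first exact: Kaut_comp.
  rewrite tx !(fmorph_div, rmorphXn) sx sy.
  by field; rewrite x0 oner_neq0.
by rewrite ty fmorph_div sx sy; field; rewrite x0 oner_neq0.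
Qed.

Lemma rho2_exists : exists s : {rmorphism L -> L},
  [/\ is_Kaut iota s, s x = x / z & s y = y / z].
Proof.
have [s [sK sx sy]] := theta2_exists; have [t [tK tx ty]] := theta3_exists.
have x0 := x_neq0; have y0 := y_neq0.
exists (t \o s); split=> /=; first exact: Kaut_comp.
  by rewrite sx fmorphV tx; field; rewrite x0 y0.
by rewrite sy fmorph_div tx ty; field; rewrite x0 y0.
Qed.

Lemma zeta_point : exists zeta, [/\ zeta != 0, zeta ^+ m = -1 & on_curve m zeta (0 : K)].
Proof.
have [c cm] := zeta_exists K m_ge4; exists c; split=> //.
  apply: contra_eqN cm => /eqP->.
  by rewrite expr0n (gtn_eqF m_gt0) eq_sym oppr_eq0 oner_eq0.
rewrite /on_curve expr0n muln_eq0 /= (gtn_eqF m_gt0) add0r mul2n -addnn exprD cm.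
by rewrite mulrNN mulr1 subrr.
Qed.

(** At the point [(zeta, 0)] the function [z] vanishes while [x] is a unit; exchanging [x] or [1]
    with [z] moves this place to a zero or a pole of [x]. *)
Lemma place_over_0_oo : (exists w, is_place iota w /\ 0 < w x) /\
  (exists w, is_place iota w /\ w x < 0).
Proof.
have [c [c0 _ c_on]] := zeta_point; have [w [wP wc wy]] := place_at_exists c0 c_on.
have [wx _] := place_center wP wc c0.
have wz : w z = 3 by rewrite place_z // wx wy.
have [s [sK sx sy]] := rho1_exists; have [t [tK tx ty]] := rho2_exists.
split.
  exists (w \o s); split; first exact: place_comp.
  by rewrite /= sx wz.
exists (w \o t); split; first exact: place_comp.
by rewrite /= tx (place_div wP) ?x_neq0 ?z_neq0 // wx wz.
Qed.

(* A polynomial in [x] and [y], by lists of coefficients in increasing degree, [y] first. *)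
Definition list_value (s : seq (seq K)) : L :=
  foldr (fun l r => foldr (fun c r => iota c + x * r) 0 l + y * r) 0 s.

Lemma list_value_eq0 s : (size s <= 3 * m)%N -> list_value s = 0 ->
  forall i k, (nth [::] s i)`_k = 0.
Proof.
move=> szs vs; pose P : {poly {poly K}} := Poly (map Poly s).
have P0 : P = 0.
  apply: (curve_independent m_ge4 m3 xT xy).
    by apply: leq_trans (size_Poly _) _; rewrite size_map.
  rewrite -{}vs /P /list_value; elim: (s) => [|l r IH] /=; first exact: ev2_0.
  rewrite cons_poly_def ev2D ev2M ev2Y IH ev2C addrC [y * _]mulrC; congr (_ + _).
  elim: l => [|c l IHl] /=; first by rewrite rmorph0 horner0.
  rewrite cons_poly_def rmorphD rmorphM /= map_polyX map_polyC hornerMXaddC IHl.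
  by rewrite addrC mulrC.
move=> i k; have [lti|gei] := ltnP i (size s); last by rewrite (nth_default [::] gei) nth_nil.
have : P`_i`_k = 0 by rewrite P0 !coef0.
by rewrite coef_Poly (nth_map [::]) // coef_Poly.
Qed.

(* [H] is the pole divisor of [(1, x, y, z)]: its order at a place [w] is
   [- min(0, w x)]. *)
Definition in_L2H (f : L) : Prop := forall w, is_place iota w ->
  (0 <= w x -> vge w 0 f) /\ (w x < 0 -> vge w (w x * 2) f).

Lemma in_L2H_const c f : in_L2H f -> in_L2H (iota c * f).
Proof.
move=> h w wP; have [h1 h2] := h w wP; split=> wx; rewrite -[X in vge _ X]add0r;
  by apply: (vgeM wP); [apply: vge_const | auto].
Qed.

Lemma in_L2H_sum (I : Type) (r : seq I) (F : I -> L) :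
  (forall i, in_L2H (F i)) -> in_L2H (\sum_(i <- r) F i).
Proof. by move=> h w wP; split=> wx; apply: (vge_sum wP) => i _; have [] := h i w wP; auto. Qed.

Lemma in_L2H_fix_x (s : {rmorphism L -> L}) f :
  is_Kaut iota s -> s x = x -> in_L2H f -> in_L2H (s f).
Proof.
move=> sK sx h w wP; have [] := h _ (place_comp sK wP); rewrite /= sx => h1 h2.
have tr n : vge (w \o s) n f -> vge w n (s f) by case=> [->|]; [rewrite rmorph0; left | right].
by split=> wx; apply: tr; auto.
Qed.

Lemma ev2_coef_wide n (P : {poly {poly K}}) : (size P <= n)%N ->
  ev2 iota P x y = \sum_(i < n) (map_poly iota P`_i).[x] * y ^+ i.
Proof.
move=> szP; rewrite ev2_coef (big_ord_widen n (fun i => (map_poly iota P`_i).[x] * y ^+ i)) //.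
rewrite big_mkcond; apply: eq_bigr => i _; case: ltnP => // /(nth_default 0) ->.
by rewrite rmorph0 horner0 mul0r.
Qed.

(* The component is the average of the conjugates of the function under [y -> w ^ k y]. *)
Lemma L2H_component (P : {poly {poly K}}) (r : {poly K}) j : (size P <= 3 * m)%N ->
  in_L2H (ev2 iota P x y / (map_poly iota r).[x]) -> (j < 3 * m)%N ->
  in_L2H ((map_poly iota P`_j).[x] / (map_poly iota r).[x] * y ^+ j).
Proof.
move=> szP; rewrite (ev2_coef_wide szP) mulr_suml.
set N := (3 * m)%N in szP *; pose u i := (map_poly iota P`_i).[x] / (map_poly iota r).[x].
have N_gt0 : (0 < N)%N by rewrite muln_gt0.
move=> hf ltj; have [w wN] : exists w : K, N.-primitive_root w.
  by apply: prim_root_exists; rewrite m3 oner_neq0.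
have [s [sK sx sy]] := theta_delta_exists (prim_expr_order wN).
have sC c : s (iota c) = iota c by case: sK.
(* [F k] is the conjugate of the function under the [k]-th power of [s]. *)
pose F k := \sum_(i < N) iota (w ^+ (i * k)) * (u i * y ^+ i).
have hF k : in_L2H (F k).
  elim: k => [|k /(in_L2H_fix_x sK sx) IH].
    have -> // : F 0%N = \sum_(i < N) (map_poly iota P`_i).[x] * y ^+ i / (map_poly iota r).[x].
    by apply: eq_bigr => i _; rewrite muln0 expr0 rmorph1 mul1r mulrAC.
  have <- // : s (F k) = F k.+1.
  rewrite rmorph_sum; apply: eq_bigr => i _.
  have su : s (u i) = u i.
    have fx (p : {poly K}) : s (map_poly iota p).[x] = (map_poly iota p).[x].
      rewrite -horner_map sx -map_poly_comp; congr (_.[_]); exact: eq_map_poly.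
    by rewrite fmorph_div !fx.
  rewrite [LHS]rmorphM sC [s (u i * _)]rmorphM su [s (y ^+ i)]rmorphXn sy.
  by rewrite exprMn mulnS exprD rmorphM -rmorphXn; ring.
(* Orthogonality of the powers of [w] isolates the exponent [j]. The sum is already an average,
   since [N = 1] in [K]. *)
have <- : \sum_(k < N) iota (w ^+ ((N - j) * k)) * F k = u j * y ^+ j.
  transitivity (\sum_(i < N) u i * y ^+ i * iota (\sum_(k < N) (w ^+ (N - j + i)) ^+ k)).
    rewrite (eq_bigr _ (fun k _ => mulr_sumr _ _ _ _)) exchange_big /=.
    apply: eq_bigr => i _; rewrite rmorph_sum mulr_sumr; apply: eq_bigr => k _.
    by rewrite -exprM mulnDl exprD rmorphM; ring.
  rewrite (bigD1 (Ordinal ltj)) //= [X in _ + X]big1 => [|i ij].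
    rewrite addr0 subnK 1?ltnW // (prim_expr_order wN).
    rewrite (eq_bigr _ (fun k _ => expr1n _ _)) sumr_const card_ord.
    by rewrite m3 rmorph1 mulr1.
  set t := w ^+ _; have tN : t ^+ N = 1 by rewrite -exprM mulnC exprM (prim_expr_order wN) expr1n.
  have t1 : t - 1 != 0.
    rewrite subr_eq0 -(prim_order_dvd wN); apply: contra ij => dv; apply/eqP/val_inj => /=.
    exact: dvdn_sub_add (ltn_ord i) ltj dv.
  suff -> : \sum_(k < N) t ^+ k = 0 by rewrite rmorph0 mulr0.
  by apply: (mulfI t1); rewrite -subrX1 tN subrr mulr0.
by apply: in_L2H_sum => k; apply: in_L2H_const.
Qed.

(** Nonzero roots of the denominator are removed one at a time. If [p] does not vanish at such a
    root [a], a place over [a] gives a pole that [y ^ j] cannot cancel, by [slope_contradiction]. *)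
Lemma L2H_denominator j u (p r1 : {poly K}) k : (j < 3 * m)%N -> p != 0 -> r1 != 0 -> r1.[0] != 0 ->
  u = (map_poly iota p).[x] / (x ^+ k * (map_poly iota r1).[x]) ->
  in_L2H (u * y ^+ j) -> exists p' : {poly K}, p' != 0 /\ u = (map_poly iota p').[x] / x ^+ k.
Proof.
move=> ltj; have [n] := ubnP (size r1); elim: n => // n IH in p r1 *.
rewrite ltnS => szr p0 r0 r10 uE hu.
have x0 := x_neq0; have y0 := y_neq0.
have R0 := poly_x_neq0 r0; have P0 := poly_x_neq0 p0.
have [sz1|sz1] := eqVneq (size r1) 1%N.
  have /size_poly1P[c c0 rE] : size r1 == 1%N by apply/eqP.
  exists (c^-1%:P * p); split; first by rewrite mulf_neq0 // polyC_eq0 invr_neq0.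
  rewrite uE rE rmorphM /= !map_polyC hornerM !hornerC /= fmorphV.
  by field; rewrite expf_neq0 // fmorph_eq0 c0.
have /closed_rootP [a ra] := sz1.
have a0 : a != 0 by apply: contraNneq r10 => a0; rewrite -rootE -a0.
have [r2 r2E] := factor_theorem _ _ ra.
have r20 : r2 != 0 by apply: contraNneq r0 => h; rewrite r2E h mul0r.
have xa0 : x - iota a != 0 by rewrite subr_eq0 x_neq.
have rxE : (map_poly iota r1).[x] = (map_poly iota r2).[x] * (x - iota a).
  by rewrite r2E rmorphM rmorphB /= map_polyX map_polyC hornerM hornerXsubC.
have [pa|pa] := eqVneq p.[a] 0.
  have [p2 p2E] := factor_theorem _ _ (introT eqP pa : root p a).
  apply: (IH p2 r2) => //.
  - move: szr; rewrite r2E size_Mmonic ?monicXsubC // size_XsubC addn2 //.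
  - by apply: contraNneq p0 => h; rewrite p2E h mul0r.
  - by move: r10; rewrite r2E hornerM mulf_eq0; case/norP.
  rewrite uE rxE p2E rmorphM rmorphB /= map_polyX map_polyC hornerM hornerXsubC.
  by field; rewrite expf_neq0 // xa0 poly_x_neq0.
have [w [wP wa]] := place_over a0.
have [wx wy] := place_center wP wa a0.
have [wp _] := place_horner_unit wP wa pa.
have wy0 : 0 <= w y by apply: place_y_ge0 => //; rewrite wx.
have wr : w (x - iota a) <= w (map_poly iota r1).[x].
  rewrite rxE (placeM wP) ?poly_x_neq0 // lerDr.
  by apply: (vgeE (poly_x_neq0 r20)); apply: vge_horner => //; right; rewrite wx.
have [h _] := hu w wP; have : 0 <= w (u * y ^+ j).
  apply: vgeE (h _); last by rewrite wx.
  by rewrite uE !mulf_neq0 ?invr_neq0 ?mulf_neq0 ?expf_neq0.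
rewrite uE (placeM wP) ?mulf_neq0 ?invr_neq0 ?mulf_neq0 ?expf_neq0 //.
rewrite (place_div wP) ?mulf_neq0 ?expf_neq0 // (placeM wP) ?expf_neq0 //.
rewrite !(placeX wP) // wx wp.
rewrite mul0r !add0r addrC => h3.
by case: (slope_contradiction ltj wy wr wy0 (vgeE xa0 wa) h3).
Qed.

(** At a pole of [x] the value of [y] is two thirds of that of [x], while [2H] allows a pole of
    twice the order of that of [x]. *)
Lemma L2H_degree j (p : {poly K}) : p != 0 ->
  in_L2H ((map_poly iota p).[x] / x ^+ (j %/ 3) * y ^+ j) ->
  (3 * (size p).-1 + 2 * j <= 6 + 3 * (j %/ 3))%N.
Proof.
have x0 := x_neq0; have y0 := y_neq0.
move=> p0 h; have [_ [w [wP wx]]] := place_over_0_oo.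
have [wp P0] := place_horner_pole wP x0 wx p0.
have [_ /(_ wx)] := h w wP; move/vgeE.
rewrite !mulf_neq0 ?invr_neq0 ?expf_neq0 // => /(_ isT).
rewrite (placeM wP) ?mulf_neq0 ?invr_neq0 ?expf_neq0 //.
rewrite (place_div wP) ?expf_neq0 // !(placeX wP) // wp.
have := place_x_neg wP wx.
move: (w x) (w y) wx (size p).-1 (j %/ 3)%N => A B A0 d J AB le.
have e : B * j%:Z * 3 = A * (2 * j)%:Z by rewrite mulrAC AB PoszM; ring.
have : A * 6 <= A * (3 * d + 2 * j)%:Z - A * (3 * J)%:Z.
  have -> : A * (3 * d + 2 * j)%:Z - A * (3 * J)%:Z = (A * d%:Z - A * J%:Z + B * j%:Z) * 3.
    by rewrite mulrDl e PoszD !PoszM; ring.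
  by lia.
rewrite -mulrBr ler_nM2l //; lia.
Qed.

(** At a zero of [x] the value of [y] is a third of that of [x], so [y ^ j] compensates at most
    [x ^ (j %/ 3)] in the denominator. *)
Lemma L2H_numerator j u (p : {poly K}) k : p != 0 ->
  u = (map_poly iota p).[x] / x ^+ k -> in_L2H (u * y ^+ j) -> exists p' : {poly K},
  [/\ p' != 0, u = (map_poly iota p').[x] / x ^+ (j %/ 3) &
      (3 * (size p').-1 + 2 * j <= 6 + 3 * (j %/ 3))%N].
Proof.
have x0 := x_neq0; have y0 := y_neq0.
elim: k p => [|k IH] p p0 uE hu.
  exists (p * 'X^(j %/ 3)).
  have p'0 : p * 'X^(j %/ 3) != 0 by rewrite mulf_neq0 // -size_poly_eq0 size_polyXn.
  have uE' : u = (map_poly iota (p * 'X^(j %/ 3))).[x] / x ^+ (j %/ 3).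
    by rewrite uE rmorphM /= map_polyXn hornerM hornerXn mulfK ?expf_neq0 // expr0 divr1.
  by rewrite uE' in hu; split=> //; apply: L2H_degree p'0 hu.
have [lek|ltk] := leqP k.+1 (j %/ 3).
  exists (p * 'X^(j %/ 3 - k.+1)).
  have p'0 : p * 'X^(j %/ 3 - k.+1) != 0 by rewrite mulf_neq0 // -size_poly_eq0 size_polyXn.
  have uE' : u = (map_poly iota (p * 'X^(j %/ 3 - k.+1))).[x] / x ^+ (j %/ 3).
    rewrite uE rmorphM /= map_polyXn hornerM hornerXn -[in RHS](subnK lek) addnK exprD.
    by field; rewrite !expf_neq0.
  by rewrite uE' in hu; split=> //; apply: L2H_degree p'0 hu.
have [p0'|p0'] := eqVneq p.[0] 0.
  have [p2 p2E] := factor_theorem _ _ (introT eqP p0' : root p 0).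
  rewrite subr0 in p2E; apply: (IH p2) => //.
    by apply: contraNneq p0 => h; rewrite p2E h mul0r.
  rewrite uE p2E rmorphM /= map_polyX hornerM hornerX exprS.
  by field; rewrite expf_neq0.
have [[w [wP wx]] _] := place_over_0_oo.
have w0 : vge w 1 (x - iota 0) by rewrite rmorph0 subr0; right.
have [wp P0] := place_horner_unit wP w0 p0'.
have [/(_ (ltW wx)) + _] := hu w wP; rewrite uE => /vgeE.
rewrite !mulf_neq0 ?invr_neq0 ?expf_neq0 // => /(_ isT).
rewrite (placeM wP) ?mulf_neq0 ?invr_neq0 ?expf_neq0 //.
rewrite (place_div wP) ?expf_neq0 // !(placeX wP) // wp.
have := place_x_pos wP wx; move: (w x) (w y) wx => A B A0 AB h.
have : 0 <= B * (j%:Z - (3 * k.+1)%:Z) by move: h; rewrite -AB mulrBr PoszM; lia.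
rewrite pmulr_rge0; last by lia.
have := divn_eq j 3; have := ltn_pmod j (isT : 0 < 3)%N.
move: ltk; move: (j %/ 3)%N (j %% 3)%N; lia.
Qed.

(** The general quadratic form in [1, x, y, z], with its ten monomials grouped by powers of [y] and
    [z]. *)
Definition L2H_form (c0 c1 c2 c3 c4 c5 c6 c7 c8 c9 : K) : L :=
  iota c0 + iota c1 * x + iota c2 * x ^+ 2 + (iota c3 + iota c4 * x) * y
  + iota c5 * y ^+ 2 + (iota c6 + iota c7 * x) * z + iota c8 * (y * z) + iota c9 * z ^+ 2.

Lemma L2H_span f : in_L2H f -> exists c0 c1 c2 c3 c4 c5 c6 c7 c8 c9,
  f = L2H_form c0 c1 c2 c3 c4 c5 c6 c7 c8 c9.
Proof.
have x0 := x_neq0.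
have [P [r [szP r0 fE]]] := basis_representation m_ge4 xT xy gen f; rewrite {}fE => hf.
pose u j := (map_poly iota P`_j).[x] / (map_poly iota r).[x].
have R0 := poly_x_neq0 r0.
have comp j : (j < 3 * m)%N -> exists p : {poly K},
    u j = (map_poly iota p).[x] / x ^+ (j %/ 3) /\
    (p = 0 \/ (3 * (size p).-1 + 2 * j <= 6 + 3 * (j %/ 3))%N).
  move=> ltj; have hu := L2H_component szP hf ltj; rewrite -/(u j) in hu.
  have [P0|P0] := eqVneq P`_j 0.
    by exists 0; split; [rewrite /u P0 rmorph0 horner0 !mul0r | left].
  have [k [r1 nr rE]] := multiplicity_XsubC r 0; rewrite r0 /= in nr.
  rewrite subr0 in rE.
  have r10 : r1 != 0 by apply: contraNneq r0 => h; rewrite rE h mul0r.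
  have uE : u j = (map_poly iota P`_j).[x] / (x ^+ k * (map_poly iota r1).[x]).
    rewrite /u rE rmorphM /= map_polyXn hornerM hornerXn; congr (_ / _); exact: mulrC.
  have [p [p0 uE']] := L2H_denominator ltj P0 r10 nr uE hu.
  have [p' [p'0 uE'' le]] := L2H_numerator p0 uE' hu.
  by exists p'; split=> //; right.
have u0 j : (7 <= j)%N -> (j < 3 * m)%N -> u j = 0.
  move=> le7 /comp [p [-> [->|le]]]; first by rewrite rmorph0 horner0 mul0r.
  by exfalso; have := divn_eq j 3; lia.
have -> : ev2 iota P x y / (map_poly iota r).[x] = \sum_(i < 7) u i * y ^+ i.
  rewrite (ev2_coef_wide szP) mulr_suml (big_ord_widen (3 * m) (fun i => u i * y ^+ i)); last lia.
  rewrite [RHS]big_mkcond; apply: eq_bigr => i _; rewrite mulrAC -/(u i).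
  by case: ltnP => // le7; rewrite u0 ?mul0r.
have lin n (p : {poly K}) : (size p <= n)%N ->
    (map_poly iota p).[x] = \sum_(i < n) iota p`_i * x ^+ i.
  move=> szp; rewrite (@horner_coef_wide _ n) ?size_map_poly //.
  by apply: eq_bigr => i _; rewrite coef_map.
(* [n] is the number of coefficients that the degree bound leaves; for [j = 5] it is [0]. *)
have sz j n (p : {poly K}) : (6 + 3 * (j %/ 3) < 3 * n + 2 * j)%N ->
    (p = 0 \/ (3 * (size p).-1 + 2 * j <= 6 + 3 * (j %/ 3))%N) -> (size p <= n)%N.
  by move=> lt [->|]; rewrite ?size_poly0 //; case: (size p) => //= k; lia.
have lt7 j : (j < 7)%N -> (j < 3 * m)%N by lia.
have [p0 [e0 /(sz 0%N 3%N _ isT)/lin h0]] := comp 0%N (lt7 0%N isT).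
have [p1 [e1 /(sz 1%N 2%N _ isT)/lin h1]] := comp 1%N (lt7 1%N isT).
have [p2 [e2 /(sz 2%N 1%N _ isT)/lin h2]] := comp 2%N (lt7 2%N isT).
have [p3 [e3 /(sz 3%N 2%N _ isT)/lin h3]] := comp 3%N (lt7 3%N isT).
have [p4 [e4 /(sz 4%N 1%N _ isT)/lin h4]] := comp 4%N (lt7 4%N isT).
have [p5 [e5 /(sz 5%N 0%N _ isT)/lin h5]] := comp 5%N (lt7 5%N isT).
have [p6 [e6 /(sz 6%N 1%N _ isT)/lin h6]] := comp 6%N (lt7 6%N isT).
exists p0`_0, p0`_1, p0`_2, p1`_0, p1`_1, p2`_0, p3`_0, p3`_1, p4`_0, p6`_0.
rewrite !big_ord_recr big_ord0 /= e0 e1 e2 e3 e4 e5 e6 h0 h1 h2 h3 h4 h5 h6.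
rewrite !big_ord_recr !big_ord0 /= /L2H_form.
by field; rewrite x0 oner_neq0.
Qed.

(** * The linear system of plane sections *)

Definition in_V (f : L) : Prop := exists c0 c1 c2 c3 : K,
  f = iota c0 + iota c1 * x + iota c2 * y + iota c3 * z.

(* Each coefficient of [y ^ n] in [(x - a) f] vanishes at [x = a], by comparison with
   [(y - b) f]. *)
Lemma L2H_quotient a b f : a != 0 ->
  in_L2H ((x - iota a) * f) -> in_L2H ((y - iota b) * f) -> in_V f.
Proof.
move=> a0 /L2H_span [c0 [c1 [c2 [c3 [c4 [c5 [c6 [c7 [c8 [c9 hc]]]]]]]]]].
move=> /L2H_span [d0 [d1 [d2 [d3 [d4 [d5 [d6 [d7 [d8 [d9 hd]]]]]]]]]].
have x0 := x_neq0; have xa0 : x - iota a != 0 by rewrite subr_eq0 x_neq.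
(* The coefficients of [x ^ 2 ((y - b) C - (x - a) D)], with [C] and [D] the two quadratic forms;
   [x ^ 2] clears the denominator of [z ^ 2]. *)
pose s : seq (seq K) := [::
  [:: 0; 0; - b * c0 + a * d0; - b * c1 - d0 + a * d1; - b * c2 - d1 + a * d2; - d2];
  [:: 0; 0; c0 - b * c3 + a * d3; c1 - b * c4 - d3 + a * d4; c2 - d4];
  [:: 0; 0; c3 - b * c5 + a * d5; c4 - d5];
  [:: 0; - b * c6 + a * d6; c5 - b * c7 - d6 + a * d7; - d7];
  [:: 0; c6 - b * c8 + a * d8; c7 - d8];
  [:: 0; c8]; [:: - b * c9 + a * d9; - d9]; [:: c9]].
have sv : list_value s = 0.
  transitivity (x ^+ 2 * ((y - iota b) * L2H_form c0 c1 c2 c3 c4 c5 c6 c7 c8 c9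
      - (x - iota a) * L2H_form d0 d1 d2 d3 d4 d5 d6 d7 d8 d9)).
    rewrite /list_value /L2H_form /= !(rmorphD, rmorphB, rmorphM, rmorphN, rmorph0).
    by field; rewrite x0.
  by rewrite -hc -hd; ring.
have szs : (size s <= 3 * m)%N by rewrite /=; lia.
have e := list_value_eq0 szs sv.
have e9 : c9 = 0 := e 7%N 0%N.
have e8 : c8 = 0 := e 5%N 1%N.
have d9E : - d9 = 0 := e 6%N 1%N.
have d8E : c7 - d8 = 0 := e 4%N 2%N.
have e6 : c6 - b * c8 + a * d8 = 0 := e 4%N 1%N.
have d7E : - d7 = 0 := e 3%N 3%N.
have d6E : - b * c6 + a * d6 = 0 := e 3%N 1%N.
have e5 : c5 - b * c7 - d6 + a * d7 = 0 := e 3%N 2%N.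
have d5E : c4 - d5 = 0 := e 2%N 3%N.
have e3 : c3 - b * c5 + a * d5 = 0 := e 2%N 2%N.
have d4E : c2 - d4 = 0 := e 1%N 4%N.
have d3E : c1 - b * c4 - d3 + a * d4 = 0 := e 1%N 3%N.
have e0 : c0 - b * c3 + a * d3 = 0 := e 1%N 2%N.
have {}d8E := esym (subr0_eq d8E); have {}d5E := esym (subr0_eq d5E).
have {}d4E := esym (subr0_eq d4E).
have {}e6 : c6 = - (a * c7) by apply: subr0_eq; rewrite -[RHS]e6 e8 d8E; ring.
have {}d6E : d6 = - (b * c7).
  by apply: (mulfI a0); apply: subr0_eq; rewrite -[RHS]d6E e6; ring.
have {}e5 : c5 = 0 by rewrite -[RHS]e5 d6E -[d7]opprK d7E; ring.
have {}e3 : c3 = - (a * c4) by apply: subr0_eq; rewrite -[RHS]e3 e5 d5E; ring.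
have {}d3E : d3 = c1 - b * c4 + a * c2.
  by apply/esym; apply: subr0_eq; rewrite -[RHS]d3E d4E; ring.
have {}e0 : c0 = - (a * c1 + a ^+ 2 * c2).
  by apply: subr0_eq; rewrite -[RHS]e0 d3E e3; ring.
exists (c1 + a * c2), c2, c4, c7.
apply: (mulfI xa0); rewrite hc e0 e3 e5 e6 e8 e9 /L2H_form.
rewrite !(rmorphD, rmorphB, rmorphM, rmorphN, rmorph0, rmorphXn) /=.
by field.
Qed.

Lemma vge_V w f : is_place iota w -> in_V f -> vge w (Num.min 0 (w x)) f.
Proof.
move=> wP [c0 [c1 [c2 [c3 ->]]]]; set n := Num.min 0 (w x).
have n0 : n <= 0 by rewrite ge_min lexx.
have nx : n <= w x by rewrite ge_min lexx orbT.
have [ny nz] : n <= w y /\ n <= w z.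
  rewrite place_z // /n; have [wx|wx|wx] := ltgtP (w x) 0.
  - by have := place_x_neg wP wx; lia.
  - by have := place_x_pos wP wx; lia.
  - have w0 : 0 <= w x by rewrite wx.
    by have := place_y_ge0 wP w0; lia.
have tm c g : n <= w g -> vge w n (iota c * g).
  by move=> h; rewrite -[n]add0r; apply: (vgeM wP); [apply: vge_const | right].
apply: (vgeD wP); last exact: tm.
apply: (vgeD wP); last exact: tm.
apply: (vgeD wP); last exact: tm.
by rewrite -[iota c0]mulr1; apply: tm; rewrite (place_one wP).
Qed.

(** Membership in [L((q + 1) T)], with [q + 1 = 3 m]. Places are compared on nonzero functions
    because their value at [0] is arbitrary. *)
Definition poles_at (T : L -> int) (f : L) : Prop :=
  vge T (- (3 * m)%:Z) f /\
  forall w, is_place iota w -> (forall g, g != 0 -> w g = T g) \/ vge w 0 f.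

(* Up to a multiplier [L((q + 1) T)] consists of plane sections. *)
Definition hyperplane_place (T : L -> int) : Prop :=
  exists f, f != 0 /\ forall g, poles_at T g -> in_V (f * g).

Variable q : nat.
Hypotheses (q_succ : q.+1 = (3 * m)%N)
  (frobenius : forall u v : L, (u - v) ^+ q = u ^+ q - v ^+ q).

(** * Osculating planes and the spaces [L((q + 1) T)] *)

Section OsculatingPlane.
Variables a b : K.

Definition osculating_plane : L :=
  1 + iota (a ^+ q) * x + iota (- 3 * b ^+ q) * y + iota ((b ^+ 3 / a) ^+ q) * z.

(* Replacing [a, b, b ^ 3 / a] by [x, y, z] in the [q]-th powers gives [0]. *)
Lemma osculating_planeE : a != 0 -> osculating_plane =
  - (x - iota a) ^+ q * x - (z - iota (b ^+ 3 / a)) ^+ q * z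
  + 3 * ((y - iota b) ^+ q * y).
Proof.
move=> a0; rewrite !frobenius /osculating_plane.
have -> : iota (- 3 * b ^+ q) = - 3 * iota (b ^+ q).
  by rewrite rmorphM rmorphN rmorph_nat.
(* With [X = x ^ m] and [Z = z ^ m], the left side is [1 + X ^ 3 + Z ^ 3 - 3 X Z], which has the
   factor [1 + X + Z]. *)
have h : 1 + x ^+ q.+1 + z ^+ q.+1 - 3 * y ^+ q.+1 = 0.
  have e3 u : u ^+ q.+1 = (u ^+ m) ^+ 3 :> L by rewrite q_succ mulnC exprM.
  have ym : y ^+ q.+1 = x ^+ m * z ^+ m by rewrite q_succ -exprMn xzE exprM.
  rewrite ym !e3; set X := x ^+ m; set Z := z ^+ m.
  have -> : 1 + X ^+ 3 + Z ^+ 3 - 3 * (X * Z) =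
    (1 + X + Z) * (1 + X ^+ 2 + Z ^+ 2 - X - Z - X * Z) by ring.
  by rewrite curve_xz mul0r.
rewrite -[LHS]subr0 -[X in _ - X]h !exprS !rmorphXn; ring.
Qed.

Hypothesis a_neq0 : a != 0.
Variable T : L -> int.
Hypotheses (TP : is_place iota T) (Ta : vge T 1 (x - iota a)) (Tb : vge T 1 (y - iota b)).

(** Each term of [osculating_planeE] contains the [q]-th power of a function vanishing at [T]. *)
Lemma vge_osculating_plane : vge T q%:Z osculating_plane.
Proof.
have [Tx _] := place_center TP Ta a_neq0.
have x0 := x_neq0; have y0 := y_neq0.
have ge0 c t : vge T 1 (t - iota c) -> vge T 0 t.
  move=> tc; rewrite -[t](subrK (iota c)); apply: (vgeD TP); last exact: vge_const.
  exact: vge_le tc.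
have term c t : vge T 1 (t - iota c) -> vge T q%:Z ((t - iota c) ^+ q * t).
  move=> tc; rewrite -[q%:Z]addr0; apply: (vgeM TP); last exact: ge0 tc.
  by rewrite -[q%:Z]mul1r; apply: (vgeX TP).
have Tz : vge T 1 (z - iota (b ^+ 3 / a)).
  have -> : z - iota (b ^+ 3 / a) = (iota a * (y ^+ 2 + y * iota b + iota b ^+ 2) * (y - iota b)
      - iota b ^+ 3 * (x - iota a)) / (iota a * x).
    by rewrite fmorph_div rmorphXn; field; rewrite x0 fmorph_eq0.
  rewrite -[1]addr0; apply: (vgeM TP); last first.
    right; rewrite (placeV TP) ?mulf_neq0 ?fmorph_eq0 // (placeM TP) ?fmorph_eq0 //.
    by rewrite (placeC TP) // Tx.
  have y2 : vge T 0 (y ^+ 2) by rewrite -(mul0r 2%:Z); apply: (vgeX TP); apply: ge0 Tb.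
  apply: (vgeB TP).
    rewrite -[1]add0r; apply: (vgeM TP) => //; rewrite -[0]add0r.
    apply: (vgeM TP); first exact: vge_const.
    apply: (vgeD TP); last by rewrite -rmorphXn; apply: vge_const.
    apply: (vgeD TP) => //; rewrite -[0]add0r.
    by apply: (vgeM TP); [apply: ge0 Tb | apply: vge_const].
  by rewrite -[1]add0r -rmorphXn; apply: (vgeM TP) => //; apply: vge_const.
rewrite osculating_planeE //; apply: (vgeD TP).
  by apply: (vgeB TP); rewrite ?mulNr; [apply: (vgeN TP)|]; apply: term.
rewrite -[q%:Z]add0r -(rmorph_nat iota); apply: (vgeM TP); last exact: term.
exact: vge_const.
Qed.

Lemma osculating_plane_in_V : in_V osculating_plane.
Proof. by exists 1, (a ^+ q), (- 3 * b ^+ q), ((b ^+ 3 / a) ^+ q); rewrite rmorph1. Qed.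

Lemma osculating_plane_neq0 : osculating_plane != 0.
Proof.
have x0 := x_neq0.
pose s : seq (seq K) := [:: [:: 0; 1; a ^+ q]; [:: 0; - 3 * b ^+ q]; [::]; [:: (b ^+ 3 / a) ^+ q]].
have szs : (size s <= 3 * m)%N by rewrite /=; lia.
apply/eqP => h; have sv : list_value s = 0.
  rewrite -(mulr0 x) -h /list_value /osculating_plane /= rmorph0 rmorph1.
  by field.
have e : 1 = 0 :> K := list_value_eq0 szs sv 0%N 1%N.
by move/eqP: e; rewrite oner_eq0.
Qed.

(** The plane contributes [q] zeros at [T], and [x - a] or [y - b] one more, which offsets a pole of
    order [q + 1]. Both products lie in [L(2H)], so [L2H_quotient] applies. *)
Lemma hyperplane_place_center : hyperplane_place T.
Proof.
exists osculating_plane; split=> [|g [gT gw]]; first exact: osculating_plane_neq0.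
have [Tx _] := place_center TP Ta a_neq0.
have mem t c : vge T 1 (t - iota c) -> in_V (t - iota c) ->
    in_L2H ((t - iota c) * (osculating_plane * g)).
  move=> tc tV w wP; have [wT|w0] := gw w wP.
    have h : vge T 0 ((t - iota c) * (osculating_plane * g)).
      have -> : (0 : int) = 1 + (q%:Z - (3 * m)%:Z) by rewrite -q_succ; lia.
      by apply: (vgeM TP) => //; apply: (vgeM TP) => //; apply: vge_osculating_plane.
    rewrite (wT x x_neq0) Tx ltxx; split=> // _.
    set F := _ * _ in h *; have [->|F0] := eqVneq F 0; first by left.
    by right; rewrite (wT F F0); apply: vgeE h.
  have h : vge w (Num.min 0 (w x) * 2) ((t - iota c) * (osculating_plane * g)).
    have -> : Num.min 0 (w x) * 2 = Num.min 0 (w x) + (Num.min 0 (w x) + 0) by lia.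
    apply: (vgeM wP); first exact: vge_V.
    by apply: (vgeM wP) => //; apply: vge_V => //; apply: osculating_plane_in_V.
  by split=> wx; move: h; [rewrite min_l | rewrite min_r ?(ltW wx)].
apply: (L2H_quotient a_neq0 (b := b)); apply: mem => //.
  by exists (- a), 1, 0, 0; rewrite !rmorph0 rmorphN rmorph1; ring.
by exists (- b), 0, 1, 0; rewrite !rmorph0 rmorphN rmorph1; ring.
Qed.

End OsculatingPlane.

Lemma hyperplane_place_comp T k (s : {rmorphism L -> L}) : is_place iota T ->
  is_Kaut iota s -> k != 0 -> (forall f, in_V f -> in_V (k * s f)) ->
  hyperplane_place (T \o s) -> hyperplane_place T.
Proof.
move=> TP sK k0 sV [f [f0 fP]]; have [t [tK ts st]] := Kaut_inverse sK.
exists (k * s f); rewrite mulf_neq0 ?fmorph_eq0 //; split=> // g [gT gw].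
have tr w n : vge w n g -> vge (w \o s) n (t g).
  by case=> [->|]; [rewrite rmorph0; left | right; rewrite /= st].
rewrite -[g]st -mulrA -rmorphM; apply/sV/fP; split; first exact: tr.
move=> w wP; have [wT|w0] := gw _ (place_comp tK wP).
  by left=> h h0; rewrite -{1}[h]ts /= -wT ?fmorph_eq0.
by right; case: w0 => [->|]; [rewrite rmorph0; left | right].
Qed.

(** Where [x] is a unit the centre has nonzero first coordinate. A pole of [x] is moved there by
    exchanging [1] and [z], a zero by exchanging [x] and [z]; both exchanges preserve [V] up to a
    multiplier. *)
Lemma hyperplane_place_all T : is_place iota T -> hyperplane_place T.
Proof.
move=> TP.
have unram U : is_place iota U -> U x = 0 -> hyperplane_place U.
  move=> UP Ux; have [a Ua] : exists a, vge U 1 (x - iota a).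
    by apply: center_exists; rewrite ?Ux.
  have a0 : a != 0.
    by apply/eqP => a0; move: Ua; rewrite a0 rmorph0 subr0 => /(vgeE x_neq0); rewrite Ux.
  have [b [Ub ab]] := center_y_exists UP Ua.
  exact: (hyperplane_place_center a0 UP Ua Ub).
have x0 := x_neq0; have y0 := y_neq0; have z0 := z_neq0.
have [Tx|Tx|Tx] := ltgtP (T x) 0; last exact: unram.
- have [s [sK sx sy]] := rho2_exists; have sC c : s (iota c) = iota c by case: sK.
  apply: (hyperplane_place_comp TP sK z0).
    move=> f [c0 [c1 [c2 [c3 ->]]]]; exists c3, c1, c2, c0.
    rewrite !(rmorphD, rmorphM, fmorphV, rmorphXn) !sC sx sy.
    by field; rewrite x0 y0.
  apply: unram; first exact: place_comp.
  by rewrite /= sx (place_div TP) // place_z //; have := place_x_neg TP Tx; lia.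
- have [s [sK sx sy]] := rho1_exists; have sC c : s (iota c) = iota c by case: sK.
  apply: (hyperplane_place_comp TP sK (oner_neq0 _)).
    move=> f [c0 [c1 [c2 [c3 ->]]]]; exists c0, c3, c2, c1.
    rewrite !(rmorphD, rmorphM, fmorphV, rmorphXn) !sC sx sy.
    by field; rewrite x0 y0.
  apply: unram; first exact: place_comp.
  by rewrite /= sx place_z //; have := place_x_pos TP Tx; lia.
Qed.

Lemma Kaut_linear (s : {rmorphism L -> L}) : is_Kaut iota s ->
  exists u, u != 0 /\ forall f, in_V f -> in_V (u * s f).
Proof.
move=> sK; have [t [tK ts st]] := Kaut_inverse sK.
have [c [c0 cm c_on]] := zeta_point; have [P [PP Pc /(_ erefl) Py]] := place_at_exists c0 c_on.
have xc0 : x - iota c != 0 by rewrite subr_eq0 x_neq.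
have [f [f0 fP]] := hyperplane_place_all (place_comp tK PP).
(* For [g] in [V] the function [g / (x - c)] lies in [L((q + 1) P)], so its image under [s] has its
   poles at [P \o t], where [f] is the multiplier into [V]. *)
exists (f / s (x - iota c)); rewrite mulf_neq0 ?invr_neq0 ?fmorph_eq0 //; split=> // g gV.
rewrite mulrAC -mulrA -fmorph_div; apply: fP.
have [Px _] := place_center PP Pc c0.
(* [x - c] divides [x ^ m + 1], whose value at [P] is [3 m] because [P y = 1]. *)
have Pxc : P (x - iota c) <= (3 * m)%:Z.
  have /factor_theorem [h hE] : root ('X^m + 1) c.
    by rewrite rootE -polyC1 hornerD hornerXn hornerC cm addNr.
  have h0 : h != 0 by apply: contraNneq xm1_neq0 => h0; rewrite xm1E hE h0 mul0r rmorph0 horner0.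
  have := place_curve PP; rewrite Px Py mul0r add0r mul1r xm1E hE.
  rewrite rmorphM rmorphB /= map_polyX map_polyC hornerM hornerXsubC.
  rewrite (placeM PP) ?poly_x_neq0 // => ->; rewrite lerDr.
  by apply: (vgeE (poly_x_neq0 h0)); apply: vge_horner => //; right; rewrite Px.
split.
  have h : vge P (- (3 * m)%:Z) (g / (x - iota c)).
    rewrite -[- _]add0r; apply: (vgeM PP).
      by have := vge_V PP gV; rewrite Px min_l.
    by right; rewrite (placeV PP) // lerN2.
  by case: h => [->|h]; [rewrite rmorph0; left | right; rewrite /= ts].
move=> w wP; have sP := place_comp sK wP.
have [ws|ws] := lerP 1 (w (s (x - iota c))).
  (* Here [w \o s] is centred at [x = c], and [P] is the only such place. *)
  left=> h h0; have := place_at_unique c0 c_on erefl PP sP Pc; move=> /(_ _ (t h)).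
  by rewrite /= st => -> //; [right | rewrite fmorph_eq0].
right; suff h : vge (w \o s) 0 (g / (x - iota c)).
  by case: h => [->|]; [rewrite rmorph0; left | right].
have gw := vge_V sP gV; rewrite -[0](subrr (Num.min 0 ((w \o s) x))).
apply: (vgeM sP) => //; right; rewrite (placeV sP) // lerN2.
have [wx|wx] := lerP 0 ((w \o s) x); first by move: ws; rewrite /= ; lia.
have p0 : 'X - c%:P != 0 by rewrite polyXsubC_eq0.
have [] := place_horner_pole sP x_neq0 wx p0.
by rewrite rmorphB /= map_polyX map_polyC hornerXsubC size_XsubC /= mulr1 => ->.
Qed.

(** * Linear automorphisms *)

Section CubicRelation.
Variables c a b g : nat -> K.

Local Notation l i := (iota (c i%N) + iota (a i%N) * x + iota (b i%N) * y + iota (g i%N) * z).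

(** The cubic monomials in [1, x, y, z] are independent except for the coincidence of [y ^ 3] with
    [1 * x * z]. After multiplication by [x ^ 3] the degree in [y] is at most [9], below [3 m] since
    [m >= 4]. *)
Lemma cubic_relation : l 0 * l 1 * l 3 = l 2 ^+ 3 ->
  [/\ [/\ cubic c = 0, cubic_deriv c a = 0, cubic_deriv c b = 0 & cubic_deriv c g = 0],
      [/\ cubic a = 0, cubic_deriv a c = 0, cubic_deriv a b = 0 & cubic_deriv a g = 0],
      [/\ cubic g = 0, cubic_deriv g c = 0, cubic_deriv g a = 0 & cubic_deriv g b = 0] &
      [/\ cubic_polar c a b = 0, cubic_polar c b g = 0 & cubic_polar a b g = 0]].
Proof.
move=> lE; have x0 := x_neq0.
pose s : seq (seq K) := [::
  [:: 0; 0; 0; cubic c; cubic_deriv c a; cubic_deriv a c; cubic a];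
  [:: 0; 0; 0; cubic_deriv c b; cubic_polar c a b; cubic_deriv a b];
  [:: 0; 0; 0; cubic_deriv b c; cubic_deriv b a];
  [:: 0; 0; cubic_deriv c g; cubic_polar c a g + cubic b; cubic_deriv a g];
  [:: 0; 0; cubic_polar c b g; cubic_polar a b g];
  [:: 0; 0; cubic_deriv b g];
  [:: 0; cubic_deriv g c; cubic_deriv g a];
  [:: 0; cubic_deriv g b]; [::]; [:: cubic g]].
have szs : (size s <= 3 * m)%N by rewrite /=; lia.
have sv : list_value s = 0.
  transitivity (x ^+ 3 * (l 0 * l 1 * l 3 - l 2 ^+ 3)); last by rewrite lE subrr mulr0.
  rewrite /list_value /= rmorphD rmorph0 !rmorph_cubic !rmorph_cubic_deriv !rmorph_cubic_polar.
  by rewrite /cubic /cubic_deriv /cubic_polar /=; field.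
have e := list_value_eq0 szs sv.
by split; split; [exact: e 0%N 3%N | exact: e 0%N 4%N | exact: e 1%N 3%N | exact: e 3%N 2%N
  | exact: e 0%N 6%N | exact: e 0%N 5%N | exact: e 1%N 5%N | exact: e 3%N 4%N
  | exact: e 9%N 0%N | exact: e 6%N 1%N | exact: e 6%N 2%N | exact: e 7%N 1%N
  | exact: e 1%N 4%N | exact: e 4%N 2%N | exact: e 4%N 3%N].
Qed.

End CubicRelation.

Lemma V_independent k0 k1 k2 k3 :
  iota k0 + iota k1 * x + iota k2 * y + iota k3 * z = 0 ->
  [/\ k0 = 0, k1 = 0, k2 = 0 & k3 = 0].
Proof.
move=> h; have x0 := x_neq0.
pose s : seq (seq K) := [:: [:: 0; k0; k1]; [:: 0; k2]; [::]; [:: k3]].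
have szs : (size s <= 3 * m)%N by rewrite /=; lia.
have sv : list_value s = 0 by rewrite -(mulr0 x) -h /list_value /= rmorph0; field.
have e := list_value_eq0 szs sv.
by split; [exact: e 0%N 1%N | exact: e 0%N 2%N | exact: e 1%N 1%N | exact: e 3%N 0%N].
Qed.

Lemma three_neq0 : 3 != 0 :> K.
Proof. by apply: contra_eqN m3 => /eqP h; rewrite natrM h mul0r eq_sym oner_eq0. Qed.

(** The six pairs are the possible images of [(1, x)] under permutations of [1, x, z]. The linear
    map preserves the cubic surface, hence permutes its three singular points. *)
Lemma Kaut_monomial (s : {rmorphism L -> L}) : is_Kaut iota s ->
  exists e e' k l, [/\ (e, e') \in [:: (1, x); (x, 1); (x, z); (z, 1); (1, z); (z, x)],
    s x = iota k * (e' / e) & s y = iota l * (y / e)].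
Proof.
move=> sK; have [u [u0 uV]] := Kaut_linear sK.
have sC k : s (iota k) = iota k by case: sK.
have x0 := x_neq0; have y0 := y_neq0; have z0 := z_neq0.
have [c0 [a0 [b0 [g0 h0]]]] : in_V (u * s 1).
  by apply: uV; exists 1, 0, 0, 0; rewrite !rmorph0 rmorph1; ring.
have [c1 [a1 [b1 [g1 h1]]]] : in_V (u * s x).
  by apply: uV; exists 0, 1, 0, 0; rewrite !rmorph0 rmorph1; ring.
have [c2 [a2 [b2 [g2 h2]]]] : in_V (u * s y).
  by apply: uV; exists 0, 0, 1, 0; rewrite !rmorph0 rmorph1; ring.
have [c3 [a3 [b3 [g3 h3]]]] : in_V (u * s z).
  by apply: uV; exists 0, 0, 0, 1; rewrite !rmorph0 rmorph1; ring.
(* The rows of the matrix are independent because [s] is injective and [1, x, y, z] are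
   independent. *)
have indep k0 k1 k2 k3 :
    k0 * c0 + k1 * c1 + k2 * c2 + k3 * c3 = 0 -> k0 * a0 + k1 * a1 + k2 * a2 + k3 * a3 = 0 ->
    k0 * b0 + k1 * b1 + k2 * b2 + k3 * b3 = 0 -> k0 * g0 + k1 * g1 + k2 * g2 + k3 * g3 = 0 ->
    [/\ k0 = 0, k1 = 0, k2 = 0 & k3 = 0].
  move=> ec ea eb eg; apply: V_independent; apply: (fmorph_inj s); rewrite rmorph0.
  apply: (mulfI u0); rewrite mulr0 !rmorphD !(rmorphM s (iota _)) !sC.
  transitivity (iota k0 * (u * s 1) + iota k1 * (u * s x) + iota k2 * (u * s y) + iota k3 * (u * s z)).
    by rewrite rmorph1; ring.
  rewrite h0 h1 h2 h3.
  transitivity (iota (k0 * c0 + k1 * c1 + k2 * c2 + k3 * c3)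
    + iota (k0 * a0 + k1 * a1 + k2 * a2 + k3 * a3) * x
    + iota (k0 * b0 + k1 * b1 + k2 * b2 + k3 * b3) * y
    + iota (k0 * g0 + k1 * g1 + k2 * g2 + k3 * g3) * z).
    by rewrite !rmorphD !rmorphM; ring.
  by rewrite ec ea eb eg rmorph0; ring.
pose c := nth 0 [:: c0; c1; c2; c3]; pose a := nth 0 [:: a0; a1; a2; a3].
pose b := nth 0 [:: b0; b1; b2; b3]; pose g := nth 0 [:: g0; g1; g2; g3].
have [] := @cubic_relation c a b g.
  have sxz : s x * s z = s y ^+ 3 by rewrite -rmorphM xzE rmorphXn.
  by rewrite /= -h0 -h1 -h2 -h3 rmorph1 exprMn -sxz; ring.
rewrite /cubic /cubic_deriv /cubic_polar /c /a /b /g /=.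
move=> [cc ca cb cg] [aa ac ab ag] [gg gc ga gb] [cab cbg abg].
(* The image of a coordinate point is a singular point of the cubic: its gradient pairs to
   zero with every column of an invertible matrix. *)
have column (p0 p1 p2 p3 : K) :
    p1 * p3 * c0 + p0 * p3 * c1 + p0 * p1 * c3 - 3 * p2 ^+ 2 * c2 = 0 ->
    p1 * p3 * a0 + p0 * p3 * a1 + p0 * p1 * a3 - 3 * p2 ^+ 2 * a2 = 0 ->
    p1 * p3 * b0 + p0 * p3 * b1 + p0 * p1 * b3 - 3 * p2 ^+ 2 * b2 = 0 ->
    p1 * p3 * g0 + p0 * p3 * g1 + p0 * p1 * g3 - 3 * p2 ^+ 2 * g2 = 0 ->
    p2 = 0 /\ [\/ p1 = 0 /\ p3 = 0, p0 = 0 /\ p3 = 0 | p0 = 0 /\ p1 = 0].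
  move=> ec ea eb eg.
  have [||||e0 e1 e2 e3] := indep (p1 * p3) (p0 * p3) (- 3 * p2 ^+ 2) (p0 * p1).
  - by rewrite -[RHS]ec; ring.
  - by rewrite -[RHS]ea; ring.
  - by rewrite -[RHS]eb; ring.
  - by rewrite -[RHS]eg; ring.
  split.
    move/eqP: e2; rewrite mulNr oppr_eq0 mulf_eq0 (negPf three_neq0) expf_eq0 /=.
    by move/eqP.
  move: e0 e1 e3 => /eqP + /eqP + /eqP; rewrite !mulf_eq0.
  by have [->|?] := eqVneq p0 0; have [->|?] := eqVneq p1 0; have [->|?] := eqVneq p3 0 => //= _ _ _;
    (by apply: Or31) || (by apply: Or32) || by apply: Or33.
(* Euler's identity: the derivative of the cubic form at a point along that point is three times its
   value. *)
have triple (p0 p1 p2 p3 : K) : p0 * p1 * p3 - p2 ^+ 3 = 0 ->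
    p1 * p3 * p0 + p0 * p3 * p1 + p0 * p1 * p3 - 3 * p2 ^+ 2 * p2 = 0.
  by move=> e; rewrite -[RHS](mulr0 3) -e; ring.
have [c20 cP] := column c0 c1 c2 c3 (triple _ _ _ _ cc) ca cb cg.
have [a20 aP] := column a0 a1 a2 a3 ac (triple _ _ _ _ aa) ab ag.
have [g20 gP] := column g0 g1 g2 g3 gc ga gb (triple _ _ _ _ gg).
have b20 : b2 != 0.
  apply/eqP => b20; have [] := indep 0 0 1 0; rewrite ?c20 ?a20 ?g20 ?b20; try ring.
  by move=> _ _ /eqP; rewrite oner_eq0.
(* The columns [c], [a], [g] vanish in row 2, so a multiple of this row clears the entries in column
   [b]. *)
have row (k0 k1 k3 : K) :
    k0 * c0 + k1 * c1 + k3 * c3 = 0 -> k0 * a0 + k1 * a1 + k3 * a3 = 0 ->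
    k0 * g0 + k1 * g1 + k3 * g3 = 0 -> [/\ k0 = 0, k1 = 0 & k3 = 0].
  move=> ec ea eg.
  have [||||-> -> _ ->] // := indep k0 k1 (- (k0 * b0 + k1 * b1 + k3 * b3) / b2) k3.
  - by rewrite -[RHS]ec c20; ring.
  - by rewrite -[RHS]ea a20; ring.
  - by field.
  - by rewrite -[RHS]eg g20; ring.
have row0 : [&& c0 == 0, a0 == 0 & g0 == 0] = false.
  apply/negP => /and3P[/eqP ec /eqP ea /eqP eg].
  have [||| /eqP] := row 1 0 0; rewrite ?ec ?ea ?eg; try ring.
  by rewrite oner_eq0.
have row1 : [&& c1 == 0, a1 == 0 & g1 == 0] = false.
  apply/negP => /and3P[/eqP ec /eqP ea /eqP eg].
  have [||| _ /eqP] := row 0 1 0; rewrite ?ec ?ea ?eg; try ring.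
  by rewrite oner_eq0.
have row3 : [&& c3 == 0, a3 == 0 & g3 == 0] = false.
  apply/negP => /and3P[/eqP ec /eqP ea /eqP eg].
  have [||| _ _ /eqP] := row 0 0 1; rewrite ?ec ?ea ?eg; try ring.
  by rewrite oner_eq0.
have finish e e' k0 k1 : (e, e') \in [:: (1, x); (x, 1); (x, z); (z, 1); (1, z); (z, x)] ->
    u * s 1 = iota k0 * e -> u * s x = iota k1 * e' ->
    exists e e' k l, [/\ (e, e') \in [:: (1, x); (x, 1); (x, z); (z, 1); (1, z); (z, x)],
      s x = iota k * (e' / e) & s y = iota l * (y / e)].
  move=> ee h0' h1'; rewrite rmorph1 mulr1 in h0'.
  have e0 : e != 0 by apply: contraNneq u0 => e0; rewrite h0' e0 mulr0.
  have k00 : k0 != 0 by apply: contraNneq u0 => k00; rewrite h0' k00 rmorph0 mul0r.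
  exists e, e', (k1 / k0), (b2 / k0); split=> //; apply: (mulfI u0).
    rewrite h1' h0' fmorph_div; by field; rewrite e0 fmorph_eq0 k00.
  rewrite h2 c20 a20 g20 rmorph0 h0' fmorph_div; by field; rewrite e0 fmorph_eq0 k00.
have cell (u1 u2 u3 : K) : u1 * u2 * u3 = 0 -> u1 != 0 -> u2 != 0 -> u3 = 0.
  by move=> e n1 n2; apply: (mulfI (mulf_neq0 n1 n2)); rewrite e mulr0.
move: cP aP gP row0 row1 row3 cab cbg abg.
rewrite c20 a20 g20 !(mulr0, mul0r) !subr0.
(* Each of the columns [c], [a], [g] has at most one nonzero entry, and rows 0, 1, 3 must each meet
   one: six permutations remain. The three polar coefficients then give [b0 = b1 = b3 = 0]. *)
case=> [[c10 c30]|[c00 c30]|[c00 c10]]; case=> [[a10 a30]|[a00 a30]|[a00 a10]];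
  case=> [[g10 g30]|[g00 g30]|[g00 g10]];
  rewrite ?c00 ?c10 ?c30 ?a00 ?a10 ?a30 ?g00 ?g10 ?g30 ?eqxx ?andbT //=.
all: rewrite !(mulr0, mul0r, addr0, add0r) => n0 n1 n3 /eqP + /eqP + /eqP.
all: rewrite !mulf_eq0 n0 n1 n3 /= ?orbF => /eqP hb1 /eqP hb2 /eqP hb3.
- apply: (finish 1 x c0 a1); rewrite ?inE ?eqxx ?orbT // ?h0 ?h1;
    rewrite ?c00 ?c10 ?a00 ?a10 ?g00 ?g10 ?hb1 ?hb2 ?hb3 !rmorph0; ring.
- apply: (finish 1 z c0 g1); rewrite ?inE ?eqxx ?orbT // ?h0 ?h1;
    rewrite ?c00 ?c10 ?a00 ?a10 ?g00 ?g10 ?hb1 ?hb2 ?hb3 !rmorph0; ring.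
- apply: (finish x 1 a0 c1); rewrite ?inE ?eqxx ?orbT // ?h0 ?h1;
    rewrite ?c00 ?c10 ?a00 ?a10 ?g00 ?g10 ?hb1 ?hb2 ?hb3 !rmorph0; ring.
- apply: (finish z 1 g0 c1); rewrite ?inE ?eqxx ?orbT // ?h0 ?h1;
    rewrite ?c00 ?c10 ?a00 ?a10 ?g00 ?g10 ?hb1 ?hb2 ?hb3 !rmorph0; ring.
- apply: (finish x z a0 g1); rewrite ?inE ?eqxx ?orbT // ?h0 ?h1;
    rewrite ?c00 ?c10 ?a00 ?a10 ?g00 ?g10 ?hb1 ?hb2 ?hb3 !rmorph0; ring.
- apply: (finish z x g0 a1); rewrite ?inE ?eqxx ?orbT // ?h0 ?h1;
    rewrite ?c00 ?c10 ?a00 ?a10 ?g00 ?g10 ?hb1 ?hb2 ?hb3 !rmorph0; ring.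
Qed.

Lemma diagonal_Kaut (s : {rmorphism L -> L}) k l : is_Kaut iota s ->
  s x = iota k * x -> s y = iota l * y -> k ^+ m = 1 /\ l ^+ (3 * m) = 1.
Proof.
move=> sK sx sy; have x0 := x_neq0.
have k0 : k != 0.
  by apply: contraNneq x0 => k0; rewrite -(fmorph_eq0 s) sx k0 rmorph0 mul0r.
have e1 := congr1 s curve_xy.
rewrite rmorphXn rmorphN rmorphM rmorphD rmorph1 !rmorphXn sx sy !exprMn curve_xy -!rmorphXn in e1.
have xm : x ^+ m != 0 by rewrite expf_neq0.
(* The difference of the transformed equation and [l ^ (3 m)] times the original, divided by [x ^ m]
   up to sign; both its coefficients must vanish. *)
pose p : {poly K} := (l ^+ (3 * m) - k ^+ (2 * m))%:P * 'X^m + (l ^+ (3 * m) - k ^+ m)%:P.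
have p0 : p = 0.
  apply: xT; apply: (mulfI xm); rewrite mulr0 rmorphD rmorphM /= map_polyXn !map_polyC.
  rewrite hornerD hornerM hornerXn !hornerC /= !rmorphB.
  have -> : k ^+ (2 * m) = k ^+ m * k ^+ m by rewrite mul2n -addnn exprD.
  rewrite [iota (k ^+ m * k ^+ m)]rmorphM.
  by move/eqP: e1; rewrite -subr_eq0 => /eqP e1; rewrite -[RHS]oppr0 -e1; ring.
have h0 : l ^+ (3 * m) = k ^+ m.
  have /polyP/(_ 0%N) := p0; rewrite coefD coefCM coefXn coefC coef0 (ltn_eqF m_gt0) /=.
  by rewrite mulr0 add0r => /subr0_eq.
have h1 : l ^+ (3 * m) = k ^+ (2 * m).
  have /polyP/(_ m) := p0; rewrite coefD coefCM coefXn coefC coef0 eqxx (gtn_eqF m_gt0) /=.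
  by rewrite mulr1 addr0 => /subr0_eq.
have km : k ^+ m = 1.
  apply: (mulfI (expf_neq0 m k0)); rewrite mulr1 -exprD addnn -mul2n -h1; exact: h0.
by rewrite h0.
Qed.

(** * Comparison with the group [G] *)

Local Notation in_G := (in_G_X3 q iota x y).

Lemma in_G_generator s : is_Kaut iota s -> is_generator_X3 q iota x y s -> in_G s.
Proof. by move=> sK sG; exists [:: s]; split=> //; constructor=> //; split=> //; left. Qed.

Lemma in_G_comp s t : in_G s -> in_G t -> in_G (s \o t).
Proof.
case=> ss [Fs sE] [ts [Ft tE]]; exists (ss ++ ts); split; first by apply/List.Forall_app.
move=> u; rewrite /= sE tE foldr_cat; set g := foldr _ id ts.
by elim: (ss) => //= r rs IH; rewrite IH.
Qed.

Lemma in_G_Kaut s : in_G s -> is_Kaut iota s.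
Proof.
case=> ts [Fts sE].
have tsK : is_Kaut iota (foldr (fun t f => t \o f) id ts).
  elim: ts Fts {sE} => [_|t ts IH Fts] /=.
    by split=> //; exists id.
  by apply: Kaut_comp; [apply: (List.Forall_inv Fts).1 | apply: IH (List.Forall_inv_tail Fts)].
case: tsK => tD tM t1 tb tK; split=> [u v|u v|||k]; rewrite ?sE //.
by apply: eq_bij tb _ _ => u; rewrite sE.
Qed.

Lemma Kaut_in_G s : is_Kaut iota s -> in_G s.
Proof.
move=> /[dup] sK /Kaut_rmorph [r rs].
have rK : is_Kaut iota r.
  by case: sK => _ _ _ sb sK; apply: is_Kaut_rmorph => [|k]; [apply: eq_bij sb _ _ | rewrite rs].
suff [ts [Ft tE]] : in_G r by exists ts; split=> // u; rewrite -rs.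
move: r rK {s sK rs} => s sK; have x0 := x_neq0; have y0 := y_neq0.
have qm : (q.+1 %/ 3 = m)%N by rewrite q_succ mulKn.
have [th2 [K2 x2 y2]] := theta2_exists; have [th3 [K3 x3 y3]] := theta3_exists.
have G2 : in_G th2 by apply: in_G_generator => //; right; left.
have G3 : in_G th3 by apply: in_G_generator => //; right; right; rewrite x3 y3 expr2 invfM mulrA.
have [e [e' [k [l [ee sx sy]]]]] := Kaut_monomial sK.
(* If [r] in [G] induces the same permutation as [s], then [r^-1 s] is diagonal, hence one of the
   generators by [diagonal_Kaut]. *)
have reduce (r : {rmorphism L -> L}) : in_G r -> r x = e' / e -> r y = y / e -> in_G s.
  move=> rG rx ry; have rK := in_G_Kaut rG; have [t [tK rt tr]] := Kaut_inverse rK.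
  have dx : (t \o s) x = iota k * x.
    by rewrite /= sx rmorphM -rx rt; case: tK => _ _ _ _ ->.
  have dy : (t \o s) y = iota l * y.
    by rewrite /= sy rmorphM -ry rt; case: tK => _ _ _ _ ->.
  have dK : is_Kaut iota (t \o s) by apply: Kaut_comp.
  have [km lm] := diagonal_Kaut dK dx dy.
  have dG : in_G (t \o s).
    by apply: in_G_generator => //; left; exists k, l; rewrite qm q_succ.
  have [ts [Ft tE]] := in_G_comp rG dG; exists ts; split=> // u.
  by rewrite -tE /= tr.
have calc := (fmorphV, rmorphM, rmorphXn, x2, x3, y2, y3).
move: ee reduce; rewrite !inE !xpair_eqE.
(* The six permutations, written as words in [th2] and [th3]. *)
case/or4P => [||| /or3P[||]] /andP[/eqP-> /eqP->] reduce.
- apply: (reduce idfun); rewrite ?divr1 //.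
  by apply: in_G_generator; [apply: is_Kaut_rmorph => //; exists id | left; exists 1, 1; rewrite !expr1n rmorph1 !mul1r].
- by apply: (reduce th2); rewrite ?div1r.
- by apply: (reduce th3).
- by apply: (reduce (th3 \o th3)); [exact: in_G_comp | |]; rewrite /= !calc; field; rewrite x0 y0.
- by apply: (reduce (th2 \o th3)); [exact: in_G_comp | |]; rewrite /= !calc; field; rewrite x0 ?oner_neq0.
- by apply: (reduce (th3 \o th2)); [exact: in_G_comp | |]; rewrite /= !calc; field; rewrite x0 y0.
Qed.

End FunctionField.

Theorem theorem6p5 (p e q : nat) (K : closedFieldType) (L : fieldType)
  (iota : {rmorphism K -> L}) (x y : L) :
  prime p -> odd p -> (0 < e)%N -> q = (p ^ e)%N -> (11 <= q)%N -> (q %% 3 = 2)%N ->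
  p \in [pchar K] -> (forall c : K, algebraic_over_prime c) ->
  is_function_field_X3 q iota x y ->
  forall s : L -> L, is_Kaut iota s <-> in_G_X3 q iota x y s.
Proof.
move=> p_pr _ e_gt0 qE q11 q3 pK _ [xT xy gen] s.
pose m := (q.+1 %/ 3)%N.
have q_succ : q.+1 = (3 * m)%N.
  by rewrite /m; move: q3; clear; lia.
have m_ge4 : (4 <= m)%N by move: q_succ q11; clear; lia.
have qK : q%:R = 0 :> K by rewrite qE natrX (pcharf0 pK) expr0n (gtn_eqF e_gt0).
(* [3 m = q + 1], and [q] is zero in characteristic [p]. *)
have m3 : (3 * m)%:R = 1 :> K by rewrite -q_succ -addn1 natrD qK add0r.
have pL : p \in [pchar L] by rewrite (fmorph_pchar iota).
have frob (u v : L) : (u - v) ^+ q = u ^+ q - v ^+ q.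
  apply: (addIr (v ^+ q)); rewrite subrK -exprDn_pchar ?subrK // qE pnatX.
  by rewrite pnatE // pL.
have on : on_curve m x y by rewrite /on_curve -q_succ addrA.
split; first exact: (Kaut_in_G m_ge4 m3 xT on gen q_succ frob).
exact: in_G_Kaut.
Qed.
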